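(* Let $E$ be a field of characteristic $p$, let $k \geq 1$ (with $k \geq 2$ if $p=2$), and let $\Gamma_k = 1+p^k\mathbf{Z}_p$ act on $\widetilde{\mathbf{E}}$ as described in the context. Then for every integer $m \geq 0$ we have $\widetilde{\mathbf{E}}^{\Gamma_k\text{-}\mathrm{sh},k-m} = \mathbf{E}_m = E(\!(X^{1/p^m})\!)$, and $\widetilde{\mathbf{E}}^{\mathrm{sh}} = \mathbf{E}_\infty = \bigcup_{n \geq 0} E(\!(X^{1/p^n})\!)$.
   Context: Let $p$ be a prime and $E$ a field of characteristic $p$. For $n \geq 0$ let $\mathbf{E}^+_n = E[[X^{1/p^n}]]$ and $\mathbf{E}_n = E(\!(X^{1/p^n})\!)$, let $\mathbf{E}_\infty = \bigcup_{n\ge 0}\mathbf{E}_n$, and let $\widetilde{\mathbf{E}}$ be the $X$-adic completion of $\mathbf{E}_\infty$, with its $X$-adic valuation $\operatorname{val}_X$ normalized by $\operatorname{val}_X(X)=1$ (so $\operatorname{val}_X(X^{1/p^n}) = 1/p^n$). The group $\mathbf{Z}_p^\times$ acts on each $\mathbf{E}_n$ by $E$-linear field automorphisms determined by $a \cdot X^{1/p^n} = (1+X^{1/p^n})^a - 1$; these actions are compatible and extend by continuity to an action on $\widetilde{\mathbf{E}}$ by isometries. For $k\ge1$ ($k \ge 2$ if $p=2$), $\Gamma_k = 1+p^k\mathbf{Z}_p$ is given the coordinate $c(1+p^k a) = a$, a bijection $\Gamma_k \to \mathbf{Z}_p$. Super-Hölder vectors: for a valued $E$-vector space $M$ (valuation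 $\operatorname{val}_M$ with $\operatorname{val}_M(xm)=\operatorname{val}_M(m)$ for $x\in E^\times$) on which a group $\Gamma$ with coordinate $c:\Gamma \to \mathbf{Z}_p$ acts $E$-linearly by isometries, and for $\lambda,\mu\in\mathbf{R}$, let $M^{\Gamma\text{-}\mathrm{sh},\lambda,\mu}$ be the set of $m \in M$ such that $\operatorname{val}_M(c^{-1}(x)\cdot m - c^{-1}(y)\cdot m) \geq p^\lambda p^i + \mu$ for all $x,y\in\mathbf{Z}_p$ and all integers $i\ge 0$ with $\operatorname{val}_p(x-y)\ge i$. Let $M^{\Gamma\text{-}\mathrm{sh},\lambda} = \bigcup_{\mu\in\mathbf{R}} M^{\Gamma\text{-}\mathrm{sh},\lambda,\mu}$, and $M^{\mathrm{sh}} = \bigcup_{\lambda\in\mathbf{R}} M^{\Gamma_k\text{-}\mathrm{sh},\lambda}$ (which does not depend on $k$). *)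

(* Defs.v *)
From HB Require Import structures.
From mathcomp Require Import all_boot all_order all_algebra.
From mathcomp Require Import boolp classical_sets functions cardinality fsbigop.
From mathcomp Require Import reals ereal exp.
From mathcomp Require Import zify ring lra.
Set Implicit Arguments. Unset Strict Implicit. Unset Printing Implicit Defensive.
Import Order.TTheory GRing.Theory Num.Theory.
Local Open Scope classical_set_scope.
Local Open Scope ring_scope.

Lemma modz_dvdm (m d e : int) : (d %| e)%Z -> ((m %% e)%Z %% d)%Z = (m %% d)%Z.
Proof.
move=> de; apply/eqP; rewrite eqz_mod_dvd {2}(divz_eq m e) opprD addrCA subrr.
by rewrite addr0 rpredN dvdz_mull.
Qed.

Section Padic.
Variable p : nat.

(* Z_p as the inverse limit of the Z/p^n: the n-th term of x is the residue of
   x in [0, p^n[. *)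
Definition padic_coherent (x : nat -> int) : bool :=
  `[< forall n, (x n.+1 %% (p ^ n)%N%:Z)%Z = x n >].

Record padic := Padic { padic_res :> nat -> int ; _ : padic_coherent padic_res }.

HB.instance Definition _ := [isSub for padic_res].
HB.instance Definition _ := [Choice of padic by <:].

Lemma padicS (x : padic) n : (x n.+1 %% (p ^ n)%N%:Z)%Z = x n.
Proof. by case: x => x /= /asboolP. Qed.

Lemma padic_mod (x : padic) n : (x n %% (p ^ n)%N%:Z)%Z = x n.
Proof. by rewrite -{1}(padicS x) modz_mod padicS. Qed.

Lemma padicP (x y : padic) : (forall n, x n = y n) <-> x = y.
Proof. by split=> [xy|->//]; apply/val_inj/funext. Qed.

Lemma padic_of_subproof (f : nat -> int) :
  (forall n, (f n.+1 = f n %[mod (p ^ n)%N%:Z])%Z) ->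
  padic_coherent (fun n => (f n %% (p ^ n)%N%:Z)%Z).
Proof.
move=> ff; apply/asboolP => n; rewrite -(ff n) modz_dvdm//.
by rewrite expnS PoszM dvdz_mull.
Qed.

Definition padic_of f ff := Padic (@padic_of_subproof f ff).

Fact padic_add_subproof (x y : padic) n :
  ((x n.+1 + y n.+1) = x n + y n %[mod (p ^ n)%N%:Z])%Z.
Proof. by rewrite -modzDm !padicS. Qed.
Fact padic_mul_subproof (x y : padic) n :
  ((x n.+1 * y n.+1) = x n * y n %[mod (p ^ n)%N%:Z])%Z.
Proof. by rewrite -modzMm !padicS. Qed.
Fact padic_opp_subproof (x : padic) n :
  (- x n.+1 = - x n %[mod (p ^ n)%N%:Z])%Z.
Proof. by rewrite -modzNm !padicS. Qed.

Definition padic_int (z : int) := @padic_of (fun=> z) (fun=> erefl).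
Definition padic_add x y := padic_of (padic_add_subproof x y).
Definition padic_mul x y := padic_of (padic_mul_subproof x y).
Definition padic_opp x := padic_of (padic_opp_subproof x).

Fact padic_addA : associative padic_add.
Proof. by move=> x y z; apply/padicP=> n /=; rewrite modzDmr modzDml addrA. Qed.
Fact padic_addC : commutative padic_add.
Proof. by move=> x y; apply/padicP=> n /=; rewrite addrC. Qed.
Fact padic_add0 : left_id (padic_int 0) padic_add.
Proof. by move=> x; apply/padicP=> n /=; rewrite modzDml add0r padic_mod. Qed.
Fact padic_addN : left_inverse (padic_int 0) padic_opp padic_add.
Proof. by move=> x; apply/padicP=> n /=; rewrite modzDml addNr. Qed.

HB.instance Definition _ := GRing.isZmodule.Build padic
  padic_addA padic_addC padic_add0 padic_addN.

Fact padic_mulA : associative padic_mul.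
Proof. by move=> x y z; apply/padicP=> n /=; rewrite modzMmr modzMml mulrA. Qed.
Fact padic_mulC : commutative padic_mul.
Proof. by move=> x y; apply/padicP=> n /=; rewrite mulrC. Qed.
Fact padic_mul1 : left_id (padic_int 1) padic_mul.
Proof. by move=> x; apply/padicP=> n /=; rewrite modzMml mul1r padic_mod. Qed.
Fact padic_mulD : left_distributive padic_mul padic_add.
Proof.
move=> x y z; apply/padicP=> n /=.
by rewrite modzMml modzDml modzDmr mulrDl.
Qed.

HB.instance Definition _ := GRing.Zmodule_isComPzRing.Build padic
  padic_mulA padic_mulC padic_mul1 padic_mulD.

(* val_p x >= i *)
Definition padic_val_ge (i : nat) (x : padic) : Prop :=
  exists z : padic, x = p%:R ^+ i * z.
End Padic.

Section Series.
Variables (E : fieldType) (p : nat).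
Implicit Types f g h : rat -> E.

(* A formal series \sum_q f_q X^q with rational exponents is encoded by its
   coefficient function f : rat -> E; [laurent n] singles out E((X^(1/p^n))). *)
Definition laurent (n : nat) f : Prop :=
  (forall q, f q != 0 -> q * p%:R ^+ n \is a Num.int) /\
  (exists M, forall q, f q != 0 -> M <= q).

(* the union of the E((X^(1/p^n))) *)
Definition laurent_oo f : Prop := exists n, laurent n f.

(* The series that are X-adic limits of elements of [laurent_oo]; the lemmas
   [etilde_dense] and [etilde_complete] below show that they form the X-adic
   completion of [laurent_oo]. *)
Definition laurent_completion f : Prop :=
  forall N : rat, exists2 g, laurent_oo g & forall q, q < N -> f q = g q.

(* val_X f >= N; see [valX_vge] *)
Definition vge (N : rat) f : Prop := forall q, q < N -> f q = 0.

Definition left_finite f : Prop :=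
  forall N : rat, finite_set [set q | q < N /\ f q != 0].

Definition pfrac_supp f : Prop :=
  forall q, f q != 0 -> exists n, q * p%:R ^+ n \is a Num.int.

(* the Cauchy product; the sum has finite support when f, g are left_finite *)
Definition smul f g : rat -> E :=
  fun r => \sum_(q \in [set: rat]) f q * g (r - q).

Lemma vgeP N f : (forall q, f q != 0 -> N <= q) <-> vge N f.
Proof.
split=> H q; last by apply: contraNle => /H ->.
by move=> qN; apply/eqP; apply: contraTT qN => /H; rewrite -leNgt.
Qed.

Lemma vge_le M N f : M <= N -> vge N f -> vge M f.
Proof. by move=> MN fN q qM; apply: fN; exact: lt_le_trans qM MN. Qed.

Lemma left_finite_vge f : left_finite f -> exists M, vge M f.
Proof.
move=> /(_ 0) /finite_seqP [s sE].
suff [M [M0 sM]] : exists M, M <= 0 /\ forall q, q \in s -> M <= q.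
  exists M; apply/vgeP => q fq; have [q0|q0] := ltP q 0; last exact: le_trans q0.
  by apply: sM; have : [set` s] q by rewrite -sE.
elim: s {sE} => [|x s [M [M0 sM]]]; first by exists 0.
exists (Order.min x M); split; first by rewrite ge_min M0 orbT.
move=> q; rewrite inE => /predU1P[->|qs]; rewrite ge_min ?lexx// sM ?orbT//.
Qed.

Lemma conv_finite f g r : left_finite f -> left_finite g ->
  finite_set [set q | f q != 0 /\ g (r - q) != 0].
Proof.
move=> lf lg; have [M /vgeP gM] := left_finite_vge lg.
apply: sub_finite_set (lf (r - M + 1)) => q [fq gq]; split => //.
by have := gM _ gq; lra.
Qed.

Lemma smulE f g r (A : set rat) :
  (forall q, f q != 0 -> g (r - q) != 0 -> A q) ->
  smul f g r = \sum_(q \in A) f q * g (r - q).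
Proof.
move=> HA; apply/esym/fsbig_widen => // q [_ nA] /=.
apply/eqP; rewrite mulf_eq0; apply: contra_notT nA.
by rewrite negb_or => /andP[]; exact: HA.
Qed.

Lemma smul_neq0 f g r : smul f g r != 0 -> exists q, f q != 0 /\ g (r - q) != 0.
Proof.
rewrite /smul; move=> /(fsbigN1 (f := fun (_ : unit) q => f q * g (r - q)) (x := tt)).
by move=> [q _]; rewrite mulf_eq0 negb_or => /andP[? ?]; exists q.
Qed.

Lemma smul_vge M N f g : vge M f -> vge N g -> vge (M + N) (smul f g).
Proof.
move=> /vgeP fM /vgeP gN; apply/vgeP => r /smul_neq0 [q [/fM + /gN]]; lra.
Qed.

Lemma smul_left_finite f g :
  left_finite f -> left_finite g -> left_finite (smul f g).
Proof.
move=> lf lg N; have [Mf /vgeP fM] := left_finite_vge lf.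
have [Mg /vgeP gM] := left_finite_vge lg.
apply: sub_finite_set (finite_image2 +%R (lf (N - Mg)) (lg (N - Mf))).
move=> r [rN /smul_neq0 [q [fq gq]]] /=.
have := fM _ fq; have := gM _ gq => ? ?.
by exists q; [split => //; lra|exists (r - q); [split => //; lra|ring]].
Qed.

Lemma pfrac_mono n m (q : rat) : (n <= m)%N ->
  q * p%:R ^+ n \is a Num.int -> q * p%:R ^+ m \is a Num.int.
Proof.
by move=> nm qn; rewrite -(subnKC nm) exprD mulrA rpredM// rpredX// rpred_nat.
Qed.

Lemma pfracD n m (q r : rat) :
  q * p%:R ^+ n \is a Num.int -> r * p%:R ^+ m \is a Num.int ->
  (q + r) * p%:R ^+ maxn n m \is a Num.int.
Proof.
move=> qn rm; rewrite mulrDl rpredD//.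
  by apply: pfrac_mono qn; rewrite leq_maxl.
by apply: pfrac_mono rm; rewrite leq_maxr.
Qed.

Lemma smul_pfrac f g : pfrac_supp f -> pfrac_supp g -> pfrac_supp (smul f g).
Proof.
move=> pf pg r /smul_neq0 [q [/pf[n qn] /pg[m rm]]].
by exists (maxn n m); rewrite -(subrK q r) addrC pfracD.
Qed.

Lemma smulC f g : smul f g = smul g f.
Proof.
apply/funext => r; rewrite /smul (reindex_fsbigT (fun q => r - q))/=.
  by apply: eq_fsbigr => q _; rewrite mulrC; congr (g _ * _); ring.
by exists (fun q => r - q) => q; ring.
Qed.

Lemma smulDl f g h : left_finite f -> left_finite g -> left_finite h ->
  smul (f \+ g) h = smul f h \+ smul g h.
Proof.
move=> lf lg lh; apply/funext => r /=.
pose A := [set q | f q != 0 /\ h (r - q) != 0] `|` [set q | g q != 0 /\ h (r - q) != 0].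
have Afin : finite_set A by rewrite finite_setU; split; exact: conv_finite.
rewrite !(@smulE _ _ r A); first 1 last.
- by move=> q fq hq; right.
- by move=> q fq hq; left.
- move=> q fgq hq; have [fq|fq] := eqVneq (f q) 0; last by left.
  by right; split => //; apply: contraNneq fgq => gq /=; rewrite fq gq addr0.
by rewrite -fsbig_split//; apply: eq_fsbigr => q _ /=; rewrite mulrDl.
Qed.

Lemma smulA f g h : left_finite f -> left_finite g -> left_finite h ->
  smul f (smul g h) = smul (smul f g) h.
Proof.
move=> lf lg lh; apply/funext => r.
have [Mf /vgeP fM] := left_finite_vge lf.
have [Mg /vgeP gM] := left_finite_vge lg.
have [Mh /vgeP hM] := left_finite_vge lh.
pose A := [set s | s < r - Mg - Mh + 1 /\ f s != 0].
pose C := [set t | t < r - Mf - Mg + 1 /\ h t != 0].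
pose B := (fun t => r - t) @` C.
have finA : finite_set A by exact: lf.
have finB : finite_set B by apply: finite_image; exact: lh.
rewrite (@smulE f _ r A); last first.
  move=> q fq /smul_neq0[s [gs hs]]; split => //.
  by have := gM _ gs; have := hM _ hs; lra.
rewrite (@smulE _ h r B); last first.
  move=> q /smul_neq0[s [fs gs]] hq; exists (r - q); last by ring.
  by split => //; have := fM _ fs; have := gM _ gs; lra.
transitivity (\sum_(s \in A) \sum_(q \in B) f s * g (q - s) * h (r - q)).
  apply: eq_fsbigr => s /set_mem[_ fs].
  rewrite /smul (reindex_fsbigT (fun q => q - s))/=; last first.
    by exists (fun q => q + s) => q; ring.
  rewrite mulr_fsumr.
  transitivity (\sum_(q \in [set: rat]) f s * g (q - s) * h (r - q)).
    by apply: eq_fsbigr => q _; rewrite mulrA; congr (_ * h _); ring.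
  apply/esym/fsbig_widen => // q [_ nB] /=.
  apply/eqP; rewrite !mulf_eq0; apply: contra_notT nB.
  rewrite !negb_or => /andP[/andP[_ gq] hq]; exists (r - q); last by ring.
  by split => //; have := fM _ fs; have := gM _ gq; lra.
rewrite exchange_fsbig//; apply: eq_fsbigr => q /set_mem[t [_ ht] <-{q}].
rewrite -mulr_fsuml; congr (_ * _); apply/esym; apply: smulE => q fq gq.
by split => //; have := gM _ gq; have := hM _ ht; lra.
Qed.

Definition smono (c : E) (a : rat) : rat -> E := fun q => if q == a then c else 0.

Lemma smono_neq0 c a q : smono c a q != 0 -> q = a.
Proof. by rewrite /smono; case: (q =P a) => // _; rewrite eqxx. Qed.

Lemma smono_left_finite c a : left_finite (smono c a).
Proof.
move=> N; apply: sub_finite_set (finite_set1 a) => q [_].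
by move/smono_neq0.
Qed.

Lemma smono_mulE c a f r : smul (smono c a) f r = c * f (r - a).
Proof.
rewrite (@smulE _ _ r [set a]); last by move=> q /smono_neq0.
by rewrite fsbig_set1 /smono eqxx.
Qed.

Lemma smul1 f : smul (smono 1 0) f = f.
Proof. by apply/funext => r; rewrite smono_mulE mul1r subr0. Qed.

Hypothesis p_gt0 : (0 < p)%N.

Let pX_gt0 n : 0 < p%:R ^+ n :> rat.
Proof. by rewrite exprn_gt0// ltr0n. Qed.

Lemma interval_finite n (M N : rat) :
  finite_set [set q | M <= q < N /\ q * p%:R ^+ n \is a Num.int].
Proof.
pose B := (Num.bound (`|M| * p%:R ^+ n) + Num.bound (`|N| * p%:R ^+ n))%N.
have Mb : `|M| * p%:R ^+ n < B%:R.
  rewrite natrD; have := archi_boundP (mulr_ge0 (normr_ge0 M) (ltW (pX_gt0 n))).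
  by have := ler0n rat (Num.bound (`|N| * p%:R ^+ n)); lra.
have Nb : `|N| * p%:R ^+ n < B%:R.
  rewrite natrD; have := archi_boundP (mulr_ge0 (normr_ge0 N) (ltW (pX_gt0 n))).
  by have := ler0n rat (Num.bound (`|M| * p%:R ^+ n)); lra.
apply: (@sub_finite_set _ _
   ((fun i : nat => (i%:R - B%:R) / p%:R ^+ n) @` `I_(B + B)));
  last exact: finite_image.
move=> q [/andP[Mq qN] /intrP[z qz]].
have zM : - B%:R < z%:~R :> rat.
  rewrite -qz; have : M * p%:R ^+ n <= q * p%:R ^+ n by rewrite ler_pM2r.
  have : - (`|M| * p%:R ^+ n) <= M * p%:R ^+ n.
    by rewrite -mulNr ler_pM2r//; have := ler_norm (- M); rewrite normrN; lra.
  lra.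
have zN : z%:~R < B%:R :> rat.
  rewrite -qz; have : q * p%:R ^+ n < N * p%:R ^+ n by rewrite ltr_pM2r.
  have : N * p%:R ^+ n <= `|N| * p%:R ^+ n by rewrite ler_pM2r// ler_norm.
  lra.
have {}zM : (- B%:Z < z)%R by rewrite -(ltr_int rat) intrN.
have {}zN : (z < B%:Z)%R by rewrite -(ltr_int rat).
exists (absz (z + B%:Z)); first by rewrite /=; lia.
have -> : (absz (z + B%:Z))%:R = z%:~R + B%:R :> rat.
  rewrite -[LHS]/((absz (z + B%:Z))%:Z%:~R) gez0_abs; last lia.
  by rewrite intrD.
by rewrite addrK -qz mulfK// gt_eqF.
Qed.

Lemma pfrac_common (s : seq rat) :
  (forall q, q \in s -> exists n, q * p%:R ^+ n \is a Num.int) ->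
  exists n, forall q, q \in s -> q * p%:R ^+ n \is a Num.int.
Proof.
elim: s => [|x s IH] H; first by exists 0%N.
have [|n Hn] := IH; first by move=> q qs; apply: H; rewrite inE qs orbT.
have [|m Hm] := H x; first by rewrite inE eqxx.
exists (maxn n m) => q; rewrite inE => /predU1P[->|/Hn].
  by apply: pfrac_mono Hm; rewrite leq_maxr.
by apply: pfrac_mono; rewrite leq_maxl.
Qed.

Lemma laurent_completionP f :
  laurent_completion f <-> pfrac_supp f /\ left_finite f.
Proof.
split=> [H|[pf lf] N].
  split=> [q fq|N].
    have [g [n [gn _]] fg] := H (q + 1).
    by exists n; apply: gn; rewrite -fg//; lra.
  have [g [n [gn [M gM]]] fg] := H N.
  apply: sub_finite_set (interval_finite n M N) => q [qN].
  by rewrite fg// => gq; split; [rewrite gM|exact: gn].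
pose g q := if q < N then f q else 0.
have gf q : g q != 0 -> q < N /\ f q != 0.
  by rewrite /g; case: ifP => //; rewrite eqxx.
exists g; last by move=> q qN; rewrite /g qN.
have [s sE] := (finite_seqP _).1 (lf N).
have [|n Hn] := @pfrac_common s.
  move=> q qs; have : [set q | q < N /\ f q != 0] q by rewrite sE.
  by move=> [_ /pf].
exists n; split.
  by move=> q /gf qf; apply: Hn; have : [set` s] q by rewrite -sE.
by have [M /vgeP HM] := left_finite_vge lf; exists M => q /gf[_]; exact: HM.
Qed.

End Series.

(* [charE] is a phantom argument: it makes E, p and the primality of p available
   to the ring structures on [Etilde charE]. *)
Record Etilde (E : fieldType) (p : nat) (charE : p \in [pchar E]) := MkEtilde {
  ecoef :> rat -> E ;
  _ : `[< laurent_completion p ecoef >] }.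

Section EtildeRing.
Variables (E : fieldType) (p : nat) (charE : p \in [pchar E]).
Notation Et := (Etilde charE).

HB.instance Definition _ := [isSub for @ecoef E p charE].
HB.instance Definition _ := [Choice of Et by <:].

Implicit Types f g h : Et.

Let p_gt0 : (0 < p)%N. Proof. exact: prime_gt0 (pcharf_prime charE). Qed.

Lemma etildeP f g : (forall q, f q = g q) <-> f = g.
Proof. by split=> [fg|->//]; apply/val_inj/funext. Qed.

Lemma etilde_completion f : laurent_completion p f.
Proof. by case: f => f /= /asboolP. Qed.

Lemma etilde_left_finite f : left_finite f.
Proof. by have /(laurent_completionP p_gt0 _)[] := etilde_completion f. Qed.

Lemma etilde_pfrac f : pfrac_supp p f.
Proof. by have /(laurent_completionP p_gt0 _)[] := etilde_completion f. Qed.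

Lemma etilde_vge f : exists M, vge M f.
Proof. exact: left_finite_vge (etilde_left_finite f). Qed.

Lemma in_etilde (f : rat -> E) : pfrac_supp p f -> left_finite f ->
  `[< laurent_completion p f >].
Proof. by move=> pf lf; apply/asboolP/laurent_completionP. Qed.

Fact ezero_subproof : `[< laurent_completion p (fun=> 0 : E) >].
Proof.
apply: in_etilde => [q|N]; first by rewrite eqxx.
by apply: sub_finite_set (finite_set0 _) => q []; rewrite eqxx.
Qed.

Fact eadd_subproof f g : `[< laurent_completion p (f \+ g) >].
Proof.
have fg q : (f \+ g) q != 0 -> f q != 0 \/ g q != 0.
  move=> /= fgq; have [fq|fq] := eqVneq (f q) 0; last by left.
  by right; apply: contraNneq fgq => gq; rewrite fq gq addr0.
apply: in_etilde => [q /fg[]|N]; [exact: etilde_pfrac..|].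
apply: (@sub_finite_set _ _
  ([set q | q < N /\ f q != 0] `|` [set q | q < N /\ g q != 0])).
  by move=> q [qN /fg[]]; [left|right].
by rewrite finite_setU; split; apply: etilde_left_finite.
Qed.

Fact escale_subproof (c : E) f : `[< laurent_completion p (fun q => c * f q) >].
Proof.
apply: in_etilde => [q|N].
  by rewrite mulf_eq0 negb_or => /andP[_]; exact: etilde_pfrac.
apply: sub_finite_set (etilde_left_finite f N) => q [qN].
by rewrite mulf_eq0 negb_or => /andP[_].
Qed.

Fact eopp_subproof f : `[< laurent_completion p (\- f) >].
Proof.
apply: in_etilde => [q|N]; first by rewrite oppr_eq0; exact: etilde_pfrac.
apply: sub_finite_set (etilde_left_finite f N) => q [qN].
by rewrite oppr_eq0.
Qed.

Fact eone_subproof : `[< laurent_completion p (smono (1 : E) 0) >].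
Proof.
apply: in_etilde; last exact: smono_left_finite.
by move=> q /smono_neq0 ->; exists 0%N; rewrite mul0r.
Qed.

Fact emul_subproof f g : `[< laurent_completion p (smul f g) >].
Proof.
apply: in_etilde; first by apply: smul_pfrac; exact: etilde_pfrac.
by apply: smul_left_finite; exact: etilde_left_finite.
Qed.

Definition ezero : Et := MkEtilde charE ezero_subproof.
Definition eone : Et := MkEtilde charE eone_subproof.
Definition eadd f g : Et := MkEtilde charE (eadd_subproof f g).
Definition eopp f : Et := MkEtilde charE (eopp_subproof f).
Definition escale c f : Et := MkEtilde charE (escale_subproof c f).
Definition emul f g : Et := MkEtilde charE (emul_subproof f g).

Fact eaddA : associative eadd.
Proof. by move=> f g h; apply/etildeP => q /=; rewrite addrA. Qed.
Fact eaddC : commutative eadd.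
Proof. by move=> f g; apply/etildeP => q /=; rewrite addrC. Qed.
Fact eadd0 : left_id ezero eadd.
Proof. by move=> f; apply/etildeP => q /=; rewrite add0r. Qed.
Fact eaddN : left_inverse ezero eopp eadd.
Proof. by move=> f; apply/etildeP => q /=; rewrite addNr. Qed.

HB.instance Definition _ := GRing.isZmodule.Build Et eaddA eaddC eadd0 eaddN.

Fact emulA : associative emul.
Proof.
by move=> f g h; apply/val_inj/smulA; exact: etilde_left_finite.
Qed.
Fact emulC : commutative emul.
Proof. by move=> f g; apply/val_inj/smulC. Qed.
Fact emul1 : left_id eone emul.
Proof. by move=> f; apply/val_inj/smul1. Qed.
Fact emulD : left_distributive emul +%R.
Proof.
by move=> f g h; apply/val_inj/smulDl; exact: etilde_left_finite.
Qed.
Fact eone_neq0 : eone != 0 :> Et.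
Proof.
apply/eqP => /etildeP/(_ 0) /=; rewrite /smono eqxx => /eqP.
by rewrite oner_eq0.
Qed.

HB.instance Definition _ := GRing.Zmodule_isComNzRing.Build Et
  emulA emulC emul1 emulD eone_neq0.

Fact escaleA (c d : E) f : escale c (escale d f) = escale (c * d) f.
Proof. by apply/etildeP => q /=; rewrite mulrA. Qed.
Fact escale1 : left_id 1 escale.
Proof. by move=> f; apply/etildeP => q /=; rewrite mul1r. Qed.
Fact escaleDr : right_distributive escale +%R.
Proof. by move=> c f g; apply/etildeP => q /=; rewrite mulrDr. Qed.
Fact escaleDl f : {morph escale^~ f : c d / c + d}.
Proof. by move=> c d; apply/etildeP => q /=; rewrite mulrDl. Qed.

HB.instance Definition _ := GRing.Zmodule_isLmodule.Build E Et
  escaleA escale1 escaleDr escaleDl.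

Fact escaleAl (c : E) f g : c *: (f * g) = (c *: f) * g.
Proof.
apply/etildeP => q /=; rewrite /smul mulr_fsumr.
by apply: eq_fsbigr => s _; rewrite mulrA.
Qed.

HB.instance Definition _ := GRing.Lmodule_isLalgebra.Build E Et escaleAl.
HB.instance Definition _ := GRing.Lalgebra_isComAlgebra.Build E Et.

Lemma coefD f g q : (f + g) q = f q + g q. Proof. by []. Qed.
Lemma coefN f q : (- f) q = - f q. Proof. by []. Qed.
Lemma coefB f g q : (f - g) q = f q - g q. Proof. by []. Qed.
Lemma coef0 q : (0 : Et) q = 0. Proof. by []. Qed.
Lemma coef1 q : (1 : Et) q = smono 1 0 q. Proof. by []. Qed.
Lemma coefM f g q : (f * g) q = smul f g q. Proof. by []. Qed.
Lemma coefZ (c : E) f q : (c *: f) q = c * f q. Proof. by []. Qed.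

Lemma vgeD N f g : vge N f -> vge N g -> vge N (f + g).
Proof. by move=> fN gN q qN; rewrite coefD fN// gN// addr0. Qed.
Lemma vgeN N f : vge N f -> vge N (- f).
Proof. by move=> fN q qN; rewrite coefN fN// oppr0. Qed.
Lemma vgeB N f g : vge N f -> vge N g -> vge N (f - g).
Proof. by move=> fN gN; apply/vgeD/vgeN. Qed.
Lemma vgeM M N f g : vge M f -> vge N g -> vge (M + N) (f * g).
Proof. exact: smul_vge. Qed.
Lemma vge0 N : vge N (0 : Et). Proof. by []. Qed.
Lemma vge1 : vge 0 (1 : Et).
Proof. by apply/vgeP => q; rewrite coef1 => /smono_neq0 ->. Qed.
Lemma vgeX N f n : vge N f -> vge (N *+ n) (f ^+ n).
Proof.
move=> fN; elim: n => [|n IHn]; first by rewrite mulr0n expr0; exact: vge1.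
by rewrite mulrS exprS; exact: vgeM.
Qed.
Lemma vge_all0 f : (forall N, vge N f) -> f = 0.
Proof. by move=> H; apply/etildeP => q; apply: (H (q + 1)); lra. Qed.

Lemma etilde_dense f N : exists2 g : Et, laurent_oo p g & vge N (f - g).
Proof.
have [g gL fg] := etilde_completion f N.
have gE : `[< laurent_completion p g >] by apply/asboolP => M; exists g.
by exists (MkEtilde charE gE) => // q qN; rewrite coefB /= fg// subrr.
Qed.

Lemma etilde_complete (u : nat -> Et) :
  (forall N, exists n0, forall m n, (n0 <= m)%N -> (n0 <= n)%N ->
     vge N (u m - u n)) ->
  exists l : Et, forall N, exists n0, forall n, (n0 <= n)%N -> vge N (u n - l).
Proof.
move=> /choice[k Hk].
pose l q := u (k (q + 1)) q.
have lE N n q : (k N <= n)%N -> q < N -> l q = u n q.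
  move=> kn qN; rewrite /l.
  transitivity (u (maxn n (k (q + 1))) q); apply/eqP; rewrite -subr_eq0 -coefB.
    by apply/eqP/(Hk (q + 1)); rewrite ?leq_maxr//; lra.
  by apply/eqP/(Hk N) => //; rewrite leq_max kn.
have lL : `[< laurent_completion p l >].
  apply/asboolP => N; have [g gL ug] := etilde_completion (u (k N)) N.
  by exists g => // q qN; rewrite -ug// -(lE N).
exists (MkEtilde charE lL) => N; exists (k N) => n kn q qN.
by rewrite coefB /= (lE N n)// subrr.
Qed.

(* f = c X^v + (terms of higher degree) with c <> 0 *)
Definition lead v f : Prop := f v != 0 /\ vge v f.

Lemma left_finite_min (f : rat -> E) q0 : left_finite f -> f q0 != 0 ->
  exists2 v, f v != 0 & vge v f.
Proof.
move=> lf fq0; have [s sE] := (finite_seqP _).1 (lf (q0 + 1)).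
have q0s : q0 \in s.
  by have : [set` s] q0 by rewrite -sE; split => //; lra.
have [v [vs vm]] : exists v, v \in s /\ forall q, q \in s -> v <= q.
  case: s q0s {sE} => // x s _; elim: s x => [x|y s IHs x].
    by exists x; rewrite mem_seq1 eqxx; split => // q; rewrite mem_seq1 => /eqP->.
  have [v [vs vm]] := IHs y; have [xv|vx] := leP x v.
    exists x; split; first by rewrite inE eqxx.
    by move=> q; rewrite inE => /predU1P[->//|/vm]; exact: le_trans.
  exists v; split; first by rewrite inE vs orbT.
  by move=> q; rewrite inE => /predU1P[->|/vm//]; exact: ltW.
have [vq0 fv] : [set q | q < q0 + 1 /\ f q != 0] v by rewrite sE.
exists v => //; apply/vgeP => q fq; have [q1|q1] := ltP q (q0 + 1).
  by apply: vm; have : [set` s] q by rewrite -sE.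
by apply: ltW; exact: lt_le_trans q1.
Qed.

Lemma etilde_lead f : f != 0 -> exists v, lead v f.
Proof.
move=> f0; have [q fq] : exists q, f q != 0.
  apply: contrapT => H; case/negP: f0; apply/eqP/etildeP => q.
  by apply/eqP; apply: contrapT => /negP fq; apply: H; exists q.
by have [v fv vv] := left_finite_min (etilde_left_finite f) fq; exists v.
Qed.

Lemma lead_neq0 v f : lead v f -> f != 0.
Proof. by case=> fv _; apply: contraNneq fv => ->. Qed.

Lemma lead_uniq v w f : lead v f -> lead w f -> v = w.
Proof.
move=> [fv /vgeP vf] [fw /vgeP wf].
by apply/eqP; rewrite eq_le vf// wf.
Qed.

Lemma lead1 : lead 0 (1 : Et).
Proof. by split; [rewrite coef1 /smono eqxx oner_eq0|exact: vge1]. Qed.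

Lemma coefM_lead v w f g : vge v f -> vge w g -> (f * g) (v + w) = f v * g w.
Proof.
move=> /vgeP fv /vgeP gw; rewrite coefM (@smulE _ _ _ _ [set v]).
  by rewrite fsbig_set1 (_ : v + w - v = w)//; ring.
by move=> q /fv + /gw /= => vq wq; apply/eqP; rewrite eq_le; lra.
Qed.

Lemma leadM v w f g : lead v f -> lead w g -> lead (v + w) (f * g).
Proof.
move=> [fv vf] [gw wg]; split; last exact: vgeM.
by rewrite coefM_lead// mulf_neq0.
Qed.

(* c X^q, meaningful for q in Z[1/p] only *)
Fact emono_subproof (c : E) (q : rat) :
  `[< laurent_completion p
        (if `[< exists n, q * p%:R ^+ n \is a Num.int >]
         then smono c q else (fun=> 0)) >].
Proof.
case: ifP => [/asboolP H|_]; last exact: ezero_subproof.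
by apply: in_etilde; [move=> r /smono_neq0 ->|exact: smono_left_finite].
Qed.

Definition emono c q : Et := MkEtilde charE (emono_subproof c q).

Lemma coef_mono c q n : q * p%:R ^+ n \is a Num.int ->
  emono c q = smono c q :> (rat -> E).
Proof. by move=> H /=; case: asboolP => // -[]; exists n. Qed.

Lemma etilde_inv f : f != 0 -> exists g, g * f = 1.
Proof.
move=> f0; have [v [fv vf]] := etilde_lead f0.
have [n vn] := etilde_pfrac fv.
have Nvn : (- v) * p%:R ^+ n \is a Num.int by rewrite mulNr rpredN.
pose m : Et := emono (f v)^-1 (- v).
pose h := 1 - m * f.
have mE r : (m * f) r = (f v)^-1 * f (r + v).
  by rewrite coefM (coef_mono _ Nvn) smono_mulE opprK.
have h0 q : h q != 0 -> 0 < q.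
  rewrite coefB coef1 mE /smono; have [->|q0] := eqVneq q 0.
    by rewrite add0r mulVf// subrr eqxx.
  rewrite sub0r oppr_eq0 mulf_eq0 negb_or => /andP[_] /((vgeP _ _).2 vf).
  by rewrite lt_neqAle eq_sym q0 /=; lra.
have [e e0 he] : exists2 e, 0 < e & vge e h.
  have [->|/etilde_lead[e [he eh]]] := eqVneq h 0; first by exists 1.
  by exists e => //; exact: h0.
have hX n1 n2 : (n1 <= n2)%N -> vge (e *+ n1) (h ^+ n2).
  move=> n12; apply: (vge_le _ (@vgeX _ _ n2 he)).
  by rewrite -(subnKC n12) mulrnDr lerDl mulrn_wge0// ltW.
pose u n := \sum_(i < n) h ^+ i.
have uE n1 : (1 - h) * u n1 = 1 - h ^+ n1 by rewrite -[1 - h]opprB mulNr -subrX1 opprB.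
have archi N : exists n1, N <= e *+ n1.
  exists (Num.bound (`|N| / e)).
  have := archi_boundP (divr_ge0 (normr_ge0 N) (ltW e0)).
  rewrite ltr_pdivrMr// mulr_natl => /ltW; apply: le_trans.
  exact: ler_norm.
have uS i : u i.+1 = u i + h ^+ i by rewrite /u big_ord_recr.
have uB a n1 : vge (e *+ n1) (u (n1 + a)%N - u n1).
  elim: a => [|a IHa]; first by rewrite addn0 subrr; exact: vge0.
  rewrite addnS uS addrAC; apply: vgeD => //.
  by apply: hX; rewrite leq_addr.
have [|l Hl] := @etilde_complete u.
  move=> N; have [n1 Nn1] := archi N; exists n1 => a b na nb.
  apply: vge_le Nn1 _; rewrite -(subnKC na) -(subnKC nb).
  have -> (x y : Et) : x - y = (x - u n1) - (y - u n1) by ring.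
  by apply: vgeB; exact: uB.
exists (l * m); rewrite -mulrA (_ : m * f = 1 - h); last by rewrite opprB addrC subrK.
rewrite mulrC; apply/eqP; rewrite -subr_eq0; apply/eqP/vge_all0 => N.
have [n0 Hn0] := Hl N; have [n1 Nn1] := archi N; pose k := maxn n0 n1.
have -> : (1 - h) * l - 1 = - ((1 - h) * (u k - l)) - h ^+ k.
  by rewrite mulrBr uE; ring.
apply: vgeB; last by apply: vge_le Nn1 (hX _ _ _); rewrite leq_maxr.
apply: vgeN; rewrite -[N]add0r; apply: vgeM; last by apply: Hn0; rewrite leq_maxl.
by apply: vgeB; [exact: vge1|apply: (vge_le _ he); exact: ltW].
Qed.

Definition einv f : Et := if f == 0 then 0 else xget 0 [set g | g * f = 1].

Fact emulV f : f != 0 -> einv f * f = 1.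
Proof.
move=> f0; rewrite /einv (negbTE f0); case: xgetP => //.
by have [g gf] := etilde_inv f0 => /(_ g).
Qed.
Fact einv0 : einv 0 = 0. Proof. by rewrite /einv eqxx. Qed.

HB.instance Definition _ := GRing.ComNzRing_isField.Build Et emulV einv0.

Lemma leadV v f : lead v f -> lead (- v) f^-1.
Proof.
move=> fv; have f0 := lead_neq0 fv.
have [w fw] : exists w, lead w f^-1 by apply: etilde_lead; rewrite invr_eq0.
have := leadM fv fw; rewrite divff// => /(lead_uniq lead1) vw.
by rewrite (_ : - v = w)//; lra.
Qed.

Lemma leadX v f n : lead v f -> lead (v * n%:R) (f ^+ n).
Proof.
move=> fv; elim: n => [|n IHn]; first by rewrite mulr0 expr0; exact: lead1.
by rewrite exprS -natr1 mulrDr mulr1 addrC; exact: leadM.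
Qed.

Lemma leadXz v f (z : int) : lead v f -> lead (v * z%:~R) (f ^ z).
Proof.
move=> fv; case: z => n; first exact: leadX.
by rewrite NegzE -exprnN intrN mulrN; apply/leadV/leadX.
Qed.

End EtildeRing.

Section Action.
Variables (E : fieldType) (p : nat) (charE : p \in [pchar E]).
Notation Et := (Etilde charE).
Implicit Types f g h : Et.

Let p_pr : prime p. Proof. exact: pcharf_prime charE. Qed.
Let p_gt0 : (0 < p)%N. Proof. exact: prime_gt0 p_pr. Qed.
Let pX_gt0 n : 0 < p%:R ^+ n :> rat.
Proof. by rewrite exprn_gt0// ltr0n. Qed.
Let pX_neq0 n : p%:R ^+ n != 0 :> rat.
Proof. by rewrite gt_eqF. Qed.

(* (1 + X^(1/p^n))^a = \sum_j 'C(a, j) X^(j/p^n). In characteristic p the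
   binomial coefficient 'C(a, j) only depends on a modulo p^j (as j < p^j), so it
   is computed from the residue a_j of a. By [pow1X_approx] below this is the
   X-adic limit of the (1 + X^(1/p^n))^(a_j). *)
Definition pow1X_coef (a : padic p) (n : nat) (r : rat) : E :=
  let t := r * p%:R ^+ n in
  if t \is a Num.nat then
    'C(absz (a (Num.truncn t)), Num.truncn t)%:R
  else 0.

Fact pow1X_subproof a n : `[< laurent_completion p (pow1X_coef a n) >].
Proof.
apply/asboolP => N; exists (pow1X_coef a n) => //; exists n.
have H q : pow1X_coef a n q != 0 -> q * p%:R ^+ n \is a Num.nat.
  by rewrite /pow1X_coef; case: ifP => //; rewrite eqxx.
split=> [q /H|]; first by rewrite natrEint => /andP[].
by exists 0 => q /H; rewrite natrEint pmulr_lge0// => /andP[].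
Qed.

Definition pow1X a n : Et := MkEtilde charE (pow1X_subproof a n).

(* The image of X^q for q = z / p^n in lowest terms. By [XactE] below, any
   other way of writing q = z / p^n yields the same series. *)
Definition Xact a (q : rat) : Et :=
  (pow1X a (logn p (absz (denq q))) - 1) ^ numq q.

(* The image of \sum_q f_q X^q, i.e. the substitution
   X^(1/p^n) |-> (1 + X^(1/p^n))^a - 1. The formula makes sense for all a in Z_p
   but is only used for a in Z_p^*; it then is an action ([eact_id],
   [eact_comp]) by E-linear ([eactD], [eactZ]) multiplicative ([eact1], [eactM])
   isometries ([valX_eact]) such that X^(1/p^n) is sent to (1 + X^(1/p^n))^a - 1
   ([eact_Xroot]), and it is the only one ([eact_unique]). *)
Definition eact_coef a f (r : rat) : E :=
  \sum_(q \in [set: rat]) f q * Xact a q r.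

Lemma pfrac_denq q n : q * p%:R ^+ n \is a Num.int ->
  denq q = (p ^ logn p (absz (denq q)))%N%:Z /\ (logn p (absz (denq q)) <= n)%N.
Proof.
move=> /intrP[z qz].
have H : numq q * (p ^ n)%N%:Z = z * denq q.
  apply/eqP; rewrite -(eqr_int rat) !intrM -qz numqE.
  by rewrite -[((p ^ n)%N%:Z)%:~R]/((p ^ n)%N%:R) natrX mulrAC.
have : (absz (denq q) %| p ^ n)%N.
  rewrite -(@Gauss_dvdr _ (absz (numq q))); last by rewrite coprime_sym coprime_num_den.
  by apply/dvdnP; exists (absz z); rewrite -(absz_nat (p ^ n)) -!abszM H.
move=> /(dvdn_pfactor _ _ p_pr)[m mn dE].
by rewrite dE pfactorK//; split => //; rewrite -dE gez0_abs// denq_ge0.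
Qed.

Lemma pow1XB1_coef a n q :
  (pow1X a n - 1) q = (pow1X a 0 - 1) (q * p%:R ^+ n).
Proof.
by rewrite !coefB !coef1 /smono /= /pow1X_coef expr0 mulr1 mulf_eq0 (negbTE (pX_neq0 n)) orbF.
Qed.

Lemma pow1XB1_gt0 a n q : (pow1X a n - 1) q != 0 -> 0 < q.
Proof.
rewrite pow1XB1_coef coefB coef1 /= /pow1X_coef expr0 mulr1 /smono.
case: ifPn => [qn|]; last first.
  by case: (eqVneq (q * p%:R ^+ n) 0) => [->|_]; rewrite ?rpred0// subrr eqxx.
have [q0|q0 _] := eqVneq (q * p%:R ^+ n) 0.
  by rewrite q0 truncn0 bin0 subrr eqxx.
move: qn q0; rewrite natrEint pmulr_lge0// mulf_eq0 negb_or.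
by move=> /andP[_ q_ge0] /andP[q0 _]; rewrite lt_neqAle eq_sym q0.
Qed.

Lemma lead_pow1XB1 a v n :
  lead v (pow1X a 0 - 1) -> lead (v / p%:R ^+ n) (pow1X a n - 1).
Proof.
move=> [lv /vgeP vv]; split; first by rewrite pow1XB1_coef divfK.
apply/vgeP => q; rewrite pow1XB1_coef => /vv.
by rewrite ler_pdivrMr.
Qed.

Lemma Xact_vge a : exists2 e, 0 < e &
  forall q n, q * p%:R ^+ n \is a Num.int -> vge (e * q) (Xact a q).
Proof.
have [H0|] := eqVneq (pow1X a 0 - 1) 0.
  exists 1 => // q n qn; rewrite /Xact.
  have -> : pow1X a (logn p (absz (denq q))) - 1 = 0.
    by apply/etildeP => r; rewrite pow1XB1_coef H0.
  rewrite mul1r exp0rz; have [/eqP|_] := eqVneq (numq q) 0.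
    by rewrite numq_eq0 => /eqP ->; exact: vge1.
  exact: vge0.
move=> /etilde_lead[e le]; exists e.
  by apply: pow1XB1_gt0 le.1.
move=> q n qn; have [_] := leadXz (numq q) (lead_pow1XB1 (logn p (absz (denq q))) le).
suff -> : e / p%:R ^+ logn p (absz (denq q)) * (numq q)%:~R = e * q by [].
set m := logn _ _; have dE : (denq q)%:~R = p%:R ^+ m :> rat.
  by rewrite (pfrac_denq qn).1 -/m -natrX.
by rewrite -dE mulrAC -mulrA divq_num_den.
Qed.

Fact eact_subproof a f : `[< laurent_completion p (eact_coef a f) >].
Proof.
have [e e0 eX] := Xact_vge a.
have H r : eact_coef a f r != 0 -> exists q, [/\ f q != 0, Xact a q r != 0 & e * q <= r].
  move=> /(fsbigN1 (f := fun (_ : unit) q => f q * Xact a q r) (x := tt)).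
  move=> [q _]; rewrite mulf_eq0 negb_or => /andP[fq Xr]; exists q; split => //.
  by have [n qn] := etilde_pfrac fq; exact: (vgeP _ _).2 (eX _ _ qn) r Xr.
apply: (in_etilde charE) => [r /H[q [_ Xr _]]|N]; first exact: etilde_pfrac Xr.
pose A := [set q | q < N / e /\ f q != 0].
apply: (@sub_finite_set _ _ (\bigcup_(q in A) [set r | r < N /\ Xact a q r != 0])).
  move=> r [rN /H[q [fq Xr qr]]]; exists q => //; split => //.
  by rewrite ltr_pdivlMr// mulrC; exact: le_lt_trans rN.
apply: bigcup_finite; first exact: etilde_left_finite.
by move=> q _; exact: etilde_left_finite.
Qed.

Definition eact a f : Et := MkEtilde charE (eact_subproof a f).

End Action.

Section ActionTheory.
Variables (E : fieldType) (p : nat) (charE : p \in [pchar E]).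
Notation Et := (Etilde charE).
Implicit Types (f g h : Et) (a b : padic p).

Let p_pr : prime p. Proof. exact: pcharf_prime charE. Qed.
Let p_gt0 : (0 < p)%N. Proof. exact: prime_gt0 p_pr. Qed.
Let pX_gt0 n : 0 < p%:R ^+ n :> rat.
Proof. by rewrite exprn_gt0// ltr0n. Qed.
Let pX_neq0 n : p%:R ^+ n != 0 :> rat.
Proof. by rewrite gt_eqF. Qed.

Definition Xroot n : Et := emono charE 1 (p%:R ^- n).

Lemma coef_Xroot n : Xroot n = smono 1 (p%:R ^- n) :> (rat -> E).
Proof. by rewrite /Xroot (@coef_mono _ _ _ _ _ n)// mulVf. Qed.

Lemma coefXrootM n f r : (f * Xroot n) r = f (r - p%:R ^- n).
Proof. by rewrite mulrC coefM coef_Xroot smono_mulE mul1r. Qed.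


Lemma coef_1XX n m r : ((1 + Xroot n) ^+ m) r =
  if r * p%:R ^+ n \is a Num.nat then 'C(m, Num.truncn (r * p%:R ^+ n))%:R else 0.
Proof.
elim: m r => [|m IHm] r.
  rewrite expr0 coef1 /smono; have [->|r0] := eqVneq r 0.
    by rewrite mul0r rpred0 truncn0.
  case: ifPn => // /natrP[u ru]; rewrite ru natrK bin0n.
  case: u ru => [|u] // /eqP; rewrite mulf_eq0 (negbTE r0).
  by rewrite (negbTE (pX_neq0 n)).
rewrite exprSr mulrDr mulr1 coefD coefXrootM !IHm mulrBl mulVf//.
set t := r * _; case: (boolP (t \is a Num.nat)) => [/natrP[u ->]|tn].
  case: u => [|u].
    by rewrite truncn0 !bin0 sub0r natrEint oppr_ge0 ler10 andbF addr0.
  by rewrite -natr1 addrK natr_nat natr1 !natrK binS natrD.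
rewrite ifN ?addr0//; apply: contra tn => tn.
by rewrite -(subrK 1 t) rpredD// rpred1.
Qed.

Lemma pchar_Et : p \in [pchar Et].
Proof. by rewrite pchar_lalg. Qed.

Lemma Frob_add f g s : (f + g) ^+ (p ^ s) = f ^+ (p ^ s) + g ^+ (p ^ s).
Proof.
apply: exprDn_pchar; rewrite (eq_pnat _ (pcharf_eq pchar_Et)).
by rewrite pnatX pnat_id.
Qed.

Lemma Frob_sub f g s : (f - g) ^+ (p ^ s) = f ^+ (p ^ s) - g ^+ (p ^ s).
Proof. by apply/eqP; rewrite eq_sym subr_eq -Frob_add subrK. Qed.

Lemma Frob_vge N f g s : vge N (f - g) ->
  vge (N * p%:R ^+ s) (f ^+ (p ^ s) - g ^+ (p ^ s)).
Proof. by move=> fg; rewrite -Frob_sub -natrX mulr_natr; exact: vgeX. Qed.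

Lemma coef_XrootX n i : Xroot n ^+ i = smono 1 (i%:R / p%:R ^+ n) :> (rat -> E).
Proof.
apply/funext; elim: i => [|i IHi] r.
  by rewrite expr0 mul0r.
rewrite exprSr coefXrootM IHi /smono; congr (if _ then _ else _).
by rewrite -natr1 mulrDl mul1r subr_eq.
Qed.

Lemma Xroot_Frob n s : Xroot (n + s) ^+ (p ^ s) = Xroot n.
Proof.
apply/etildeP => r; rewrite coef_XrootX coef_Xroot; congr (smono _ _ r).
by rewrite exprD natrX invfM mulrCA divff ?mulr1.
Qed.

Lemma XrootX_vge n i : vge (i%:R / p%:R ^+ n) (Xroot n ^+ i).
Proof. by apply/vgeP => q; rewrite coef_XrootX => /smono_neq0 ->. Qed.

Lemma vge_1D N f u : 0 <= N -> vge N f -> vge N ((1 + f) ^+ u - 1).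
Proof.
move=> N0 fN; elim: u => [|u IHu]; first by rewrite expr0 subrr; exact: vge0.
have -> : (1 + f) ^+ u.+1 - 1 = ((1 + f) ^+ u - 1) * (1 + f) + f.
  by rewrite exprSr; ring.
apply: vgeD => //; rewrite -[N]addr0; apply: vgeM => //.
by apply: vgeD; [exact: vge1|exact: vge_le fN].
Qed.

Lemma vge_subX N f g u : vge 0 f -> vge 0 g -> vge N (f - g) ->
  vge N (f ^+ u - g ^+ u).
Proof.
move=> f0 g0 fg; elim: u => [|u IHu]; first by rewrite !expr0 subrr; exact: vge0.
have -> : f ^+ u.+1 - g ^+ u.+1 = (f - g) * f ^+ u + g * (f ^+ u - g ^+ u).
  by rewrite !exprS; ring.
apply: vgeD; first rewrite -[N]addr0; last rewrite -[N]add0r; apply: vgeM => //.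
by have := @vgeX _ _ _ _ _ u f0; rewrite mul0rn.
Qed.

Lemma vge0_1X n m : vge 0 ((1 + Xroot n) ^+ m).
Proof.
apply/vgeP => q; rewrite coef_1XX; case: ifP; last by rewrite eqxx.
by rewrite natrEint pmulr_lge0// => /andP[].
Qed.

Lemma pow_mod n j m m' : (m = m' %[mod p ^ j])%N ->
  vge (p%:R ^+ j / p%:R ^+ n) ((1 + Xroot n) ^+ m - (1 + Xroot n) ^+ m').
Proof.
wlog mm : m m' / (m' <= m)%N => [H mm'|].
  have [le|/ltnW le] := leqP m' m; first exact: H.
  by rewrite -opprB; apply/vgeN/H.
move/eqP; rewrite eqn_mod_dvd// => /dvdnP[u mE].
rewrite -(subnK mm) mE exprD mulnC exprM Frob_add expr1n.
rewrite -[X in _ - X]mul1r -mulrBl -[X in vge X _]addr0.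
apply: vgeM; last exact: vge0_1X.
apply: vge_1D; first by rewrite divr_ge0// ltW.
by rewrite -natrX; exact: XrootX_vge.
Qed.

Lemma bin_mod s m m' u : (m = m' %[mod p ^ s])%N -> (u < p ^ s)%N ->
  'C(m, u)%:R = 'C(m', u)%:R :> E.
Proof.
move=> /(@pow_mod 0) H us; have := H u%:R.
rewrite expr0 divr1 -natrX ltr_nat => /(_ us) /eqP.
by rewrite coefB !coef_1XX expr0 mulr1 natr_nat natrK subr_eq0 => /eqP.
Qed.

Lemma padic_ge0 a i : 0 <= a i.
Proof. by rewrite -padic_mod modz_ge0// eqz_nat expn_eq0 -leqn0 leqNgt p_gt0. Qed.

Lemma padic_le a i j : (i <= j)%N -> (a j %% (p ^ i)%N%:Z)%Z = a i.
Proof.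
elim: j => [|j IHj]; first by rewrite leqn0 => /eqP ->; exact: padic_mod.
rewrite leq_eqVlt => /predU1P[->|]; first exact: padic_mod.
rewrite ltnS => ij; rewrite -(IHj ij) -(padicS a j) modz_dvdm//.
by rewrite dvdzE !absz_nat dvdn_exp2l.
Qed.

Lemma padic_abs_le a i j : (i <= j)%N ->
  (absz (a j) = absz (a i) %[mod p ^ i])%N.
Proof.
move=> ij; apply/eqP; rewrite -eqz_nat -!modz_nat !gez0_abs ?padic_ge0//.
by rewrite (padic_le _ ij) padic_mod.
Qed.

Lemma pow1X_approx a n j :
  vge (p%:R ^+ j / p%:R ^+ n) (pow1X charE a n - (1 + Xroot n) ^+ absz (a j)).
Proof.
move=> r; rewrite ltr_pdivlMr// coefB coef_1XX /= /pow1X_coef.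
case: ifP => [/natrP[u ->]|]; last by rewrite subrr.
rewrite natrK -natrX ltr_nat => uj; apply/eqP; rewrite subr_eq0; apply/eqP.
have [ij|/ltnW ji] := leqP u j.
  apply/esym/(@bin_mod u); first exact: padic_abs_le.
  by rewrite ltn_expl// prime_gt1.
by apply: (@bin_mod j) => //; exact: padic_abs_le.
Qed.

Lemma ex_pX (N : rat) n : exists j, N <= p%:R ^+ j / p%:R ^+ n.
Proof.
exists (Num.bound (`|N| * p%:R ^+ n)); rewrite ler_pdivlMr//.
have := archi_boundP (mulr_ge0 (normr_ge0 N) (ltW (pX_gt0 n))).
set B := Num.bound _ => NB; apply: (@le_trans _ _ B%:R).
  by apply: le_trans (ltW NB); rewrite ler_pM2r// ler_norm.
by rewrite -natrX ler_nat ltnW// ltn_expl// prime_gt1.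
Qed.

Lemma vge_eq f g : (forall N, vge N (f - g)) -> f = g.
Proof. by move=> /vge_all0/eqP; rewrite subr_eq0 => /eqP. Qed.

Lemma pow1X_Frob a n s :
  pow1X charE a (n + s) ^+ (p ^ s) = pow1X charE a n.
Proof.
apply: vge_eq => N; have [j Nj] := ex_pX N n.
have H1 := Frob_vge (s := s) (@pow1X_approx a (n + s) j).
have H2 := @pow1X_approx a n j.
move: H1; rewrite exprAC Frob_add expr1n Xroot_Frob.
rewrite exprD invfM mulrA divfK// => H1.
apply: (vge_le Nj); have := vgeB H1 H2; congr vge; congr ecoef; ring.
Qed.

Lemma pow1XB1_Frob a n s :
  (pow1X charE a (n + s) - 1) ^+ (p ^ s) = pow1X charE a n - 1.
Proof. by rewrite Frob_sub expr1n pow1X_Frob. Qed.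

Lemma XactE a q n (z : int) : q * p%:R ^+ n = z%:~R ->
  Xact charE a q = (pow1X charE a n - 1) ^ z.
Proof.
move=> qz; have [|dE mn] := @pfrac_denq E p charE q n; first by rewrite qz intr_int.
rewrite /Xact; move: dE mn; set m := logn _ _ => dE mn.
have zE : z = (p ^ (n - m))%N%:Z * numq q.
  apply/eqP; rewrite -(eqr_int rat) -qz intrM numqE dE.
  rewrite -2![(_ ^ _)%N%:Z%:~R]/((_ ^ _)%N%:R) !natrX mulrCA -exprD subnK//.
rewrite -(pow1XB1_Frob a m (n - m)) subnKC// zE -exprz_exp.
by [].
Qed.

Definition padic_unit a : Prop := exists b, b * a = 1.

Lemma padic_unitM a b : padic_unit a -> padic_unit b -> padic_unit (a * b).
Proof.
move=> [c ca] [d db]; exists (d * c).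
by rewrite -mulrA (mulrA c) ca mul1r.
Qed.

Lemma padic_unit_neq0 a : padic_unit a -> (absz (a 1%N))%:R != 0 :> E.
Proof.
move=> [b /(congr1 (fun x : padic p => x 1%N)) /= ba].
rewrite -(dvdn_pcharf charE); apply/negP => pa; move: ba.
have /dvdz_mod0P -> : ((p ^ 1)%N%:Z %| b 1%N * a 1%N)%Z.
  by rewrite dvdz_mull// dvdzE absz_nat expn1.
by rewrite modz_nat modn_small// expn1 prime_gt1.
Qed.

Section Unit.
Variables (a : padic p) (ua : padic_unit a).

Lemma lead_pow1XB1_unit n : lead (p%:R ^- n) (pow1X charE a n - 1).
Proof.
rewrite -[X in lead X _]mul1r; apply: lead_pow1XB1; split.
  rewrite coefB coef1 /smono oner_eq0 subr0 /= /pow1X_coef expr0 mulr1.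
  by rewrite rpred1 truncn1 bin1; exact: padic_unit_neq0.
apply/vgeP => q Hq; have := pow1XB1_gt0 Hq; move: Hq.
rewrite coefB coef1 /smono /= /pow1X_coef expr0 mulr1.
case: ifP => [/natrP[u ->] _|_]; first by rewrite ltr0n ler1n.
by have [->|_] := eqVneq q 0; rewrite ?ltxx// subrr eqxx.
Qed.

Lemma Xact_lead q n : q * p%:R ^+ n \is a Num.int -> lead q (Xact charE a q).
Proof.
move=> /intrP[z qz]; rewrite (XactE a qz).
have -> : q = p%:R ^- n * z%:~R by rewrite -qz mulrCA mulVf// mulr1.
exact/leadXz/lead_pow1XB1_unit.
Qed.

Lemma XactD q r n : q * p%:R ^+ n \is a Num.int -> r * p%:R ^+ n \is a Num.int ->
  Xact charE a (q + r) = Xact charE a q * Xact charE a r.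
Proof.
move=> /intrP[y qy] /intrP[z rz]; rewrite (XactE a qy) (XactE a rz).
rewrite -expfzDr; last exact: lead_neq0 (lead_pow1XB1_unit n).
by apply: XactE; rewrite mulrDl qy rz intrD.
Qed.

Lemma eactE f r (A : set rat) : (forall q, f q != 0 -> q <= r -> A q) ->
  eact a f r = \sum_(q \in A) f q * Xact charE a q r.
Proof.
move=> HA; apply/esym/fsbig_widen => // q [_ nA] /=.
apply/eqP; rewrite mulf_eq0; apply: contra_notT nA.
rewrite negb_or => /andP[fq Xq]; apply: HA => //.
have [n qn] := etilde_pfrac fq.
exact: (vgeP _ _).2 (Xact_lead qn).2 _ Xq.
Qed.

Lemma eactD f g : eact a (f + g) = eact a f + eact a g.
Proof.
apply/etildeP => r; rewrite coefD.
pose A := [set q | q < r + 1 /\ f q != 0] `|` [set q | q < r + 1 /\ g q != 0].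
have Afin : finite_set A.
  by rewrite finite_setU; split; exact: etilde_left_finite.
rewrite !(@eactE _ r A); first 1 last.
- by move=> q gq qr; right; split => //; lra.
- by move=> q fq qr; left; split => //; lra.
- move=> q; rewrite coefD => fgq qr; have [fq|fq] := eqVneq (f q) 0.
    right; split; first lra.
    by apply: contraNneq fgq => gq; rewrite fq gq addr0.
  by left; split => //; lra.
by rewrite -fsbig_split//; apply: eq_fsbigr => q _; rewrite coefD mulrDl.
Qed.

Lemma eactZ (c : E) f : eact a (c *: f) = c *: eact a f.
Proof.
apply/etildeP => r; rewrite coefZ /= /eact_coef mulr_fsumr.
by apply: eq_fsbigr => q _; rewrite mulrA.
Qed.

Lemma eactN f : eact a (- f) = - eact a f.
Proof. by rewrite -scaleN1r eactZ scaleN1r. Qed.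

Lemma eactB f g : eact a (f - g) = eact a f - eact a g.
Proof. by rewrite eactD eactN. Qed.

Lemma eact0 : eact a (0 : Et) = 0.
Proof. by rewrite -[0 in LHS](scale0r 0) eactZ scale0r. Qed.

Lemma eact_vge N f : vge N f -> vge N (eact a f).
Proof.
move=> fN r rN; rewrite (@eactE f r set0) ?fsbig_set0// => q + qr.
by rewrite fN ?eqxx//; exact: le_lt_trans rN.
Qed.

Lemma eact_lead v f : lead v f -> lead v (eact a f).
Proof.
move=> [fv vf]; split; last exact: eact_vge.
rewrite (@eactE f v [set v]).
  have [n vn] := etilde_pfrac fv.
  by rewrite fsbig_set1 mulf_neq0//; exact: (Xact_lead vn).1.
by move=> q /((vgeP _ _).2 vf) vq qv /=; apply/eqP; rewrite eq_le qv.
Qed.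

Lemma eact_vgeE N f : vge N (eact a f) <-> vge N f.
Proof.
split; last exact: eact_vge.
have [->//|/etilde_lead[v fv]] := eqVneq f 0.
move=> /vgeP H; apply: vge_le fv.2; apply: H; exact: (eact_lead fv).1.
Qed.

Lemma eact_mono c q n : q * p%:R ^+ n \is a Num.int ->
  eact a (emono charE c q) = c *: Xact charE a q.
Proof.
move=> qn; apply/etildeP => r.
rewrite (@eactE _ r [set q]) ?(coef_mono _ _ qn); last by move=> s /smono_neq0.
by rewrite fsbig_set1 /smono eqxx.
Qed.

End Unit.

Lemma etilde_ind (P : Et -> Prop) : P 0 ->
  (forall c q n, q * p%:R ^+ n \is a Num.int -> P (emono charE c q)) ->
  (forall f g, P f -> P g -> P (f + g)) ->
  (forall f, (forall N, exists2 g, P g & vge N (f - g)) -> P f) ->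
  forall f, P f.
Proof.
move=> P0 Pm PD Pc f; apply: Pc => N.
have [s sE] := (finite_seqP _).1 (etilde_left_finite f N).
have [g Pg gE] : exists2 g : Et, P g & forall q, g q = if q \in s then f q else 0.
  have : forall q, q \in s -> f q != 0.
    move=> q qs; suff : [set q | q < N /\ f q != 0] q by case.
    by rewrite sE.
  elim: s {sE} => [|x s IHs] sf; first by exists 0.
  have [|g Pg gE] := IHs; first by move=> q qs; apply: sf; rewrite inE qs orbT.
  have [xs|xs] := boolP (x \in s).
    by exists g => // q; rewrite gE inE; case: eqVneq => [->|//]; rewrite xs.
  have [n xn] := etilde_pfrac (sf _ (mem_head _ _)).
  exists (g + emono charE (f x) x); first exact: PD (Pm _ _ _ xn).
  move=> q; rewrite coefD (coef_mono _ _ xn) /smono gE inE.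
  by case: eqVneq => [->|]; rewrite ?(negbTE xs) ?add0r ?addr0.
exists g => // q qN; rewrite coefB gE; case: ifPn; first by rewrite subrr.
move=> /negP qs; rewrite subr0; apply/eqP; apply: contra_notT qs => fq.
by have : [set` s] q by rewrite -sE.
Qed.

Lemma emonoM c d q r n : q * p%:R ^+ n \is a Num.int -> r * p%:R ^+ n \is a Num.int ->
  emono charE c q * emono charE d r = emono charE (c * d) (q + r).
Proof.
move=> qn rn; have qrn : (q + r) * p%:R ^+ n \is a Num.int by rewrite mulrDl rpredD.
apply/etildeP => s; rewrite coefM !(coef_mono _ _ qn) (coef_mono _ _ rn).
rewrite (coef_mono _ _ qrn) smono_mulE /smono subr_eq (addrC r).
by case: ifP => // _; rewrite mulr0.
Qed.

Lemma emono1 : emono charE 1 0 = 1.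
Proof.
by apply/etildeP => q; rewrite (@coef_mono _ _ _ _ _ 0%N) ?mul0r.
Qed.

Section Morphism.
Variables (a : padic p) (ua : padic_unit a).

Let B f g := eact a (f * g) - eact a f * eact a g.

Let BDl f1 f2 g : B (f1 + f2) g = B f1 g + B f2 g.
Proof. by rewrite /B mulrDl !(eactD ua) mulrDl; ring. Qed.

Let BDr f g1 g2 : B f (g1 + g2) = B f g1 + B f g2.
Proof. by rewrite /B mulrDr !(eactD ua) mulrDr; ring. Qed.

Let Bvge M N f g : vge M f -> vge N g -> vge (M + N) (B f g).
Proof.
move=> fM gN; apply: vgeB; first by apply: (eact_vge ua); exact: vgeM.
by apply: vgeM; exact: (eact_vge ua).
Qed.

Lemma eactM f g : eact a (f * g) = eact a f * eact a g.
Proof.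
suff : B f g = 0 by move=> /eqP; rewrite subr_eq0 => /eqP.
have B0l h : B 0 h = 0 by rewrite /B mul0r !eact0 mul0r subrr.
have B0r h : B h 0 = 0 by rewrite /B mulr0 !eact0 mulr0 subrr.
move: f g; apply: etilde_ind => [//|c q n qn|f1 f2 H1 H2 g|f H g].
- apply: etilde_ind => [//|d r m rm|g1 g2 H1 H2|g H].
  + have {}qn := pfrac_mono (leq_maxl n m) qn.
    have {}rm := pfrac_mono (leq_maxr n m) rm.
    rewrite /B (emonoM _ _ qn rm) (eact_mono ua _ qn) (eact_mono ua _ rm).
    rewrite (@eact_mono _ ua _ _ (maxn n m)) ?mulrDl ?rpredD//.
    by rewrite (XactD ua qn rm) -scalerAl -scalerAr scalerA subrr.
  + by rewrite BDr H1 H2 addr0.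
  + apply: vge_all0 => N; have [M HM] := etilde_vge (emono charE c q).
    have [g' g'0 gg'] := H (N - M).
    rewrite -(subrK g' g) BDr g'0 addr0 (_ : N = M + (N - M)); last ring.
    exact: Bvge.
- by rewrite BDl H1 H2 addr0.
- apply: vge_all0 => N; have [M HM] := etilde_vge g.
  have [f' f'0 ff'] := H (N - M).
  rewrite -(subrK f' f) BDl f'0 addr0 (_ : N = (N - M) + M); last ring.
  exact: Bvge.
Qed.

Lemma eact1 : eact a (1 : Et) = 1.
Proof.
rewrite -emono1 (@eact_mono _ ua _ _ 0%N) ?mul0r// scale1r emono1.
by rewrite (@XactE _ _ 0%N 0) ?mul0r// expr0z.
Qed.

Lemma eact_Xroot n : eact a (Xroot n) = pow1X charE a n - 1.
Proof.
have H : p%:R ^- n * p%:R ^+ n = 1%:~R :> rat by rewrite mulVf.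
by rewrite /Xroot (@eact_mono _ ua _ _ n) ?H// scale1r (XactE a H) expr1z.
Qed.

Lemma eactX f n : eact a (f ^+ n) = eact a f ^+ n.
Proof.
elim: n => [|n IHn]; first by rewrite !expr0 eact1.
by rewrite !exprS eactM IHn.
Qed.

Lemma eactV f : eact a f^-1 = (eact a f)^-1.
Proof.
have [->|f0] := eqVneq f 0; first by rewrite invr0 eact0 invr0.
have H : eact a f^-1 * eact a f = 1 by rewrite -eactM mulVf// eact1.
have f1 : eact a f != 0 by apply: contra_eq_neq H => ->; rewrite mulr0 eq_sym oner_eq0.
by rewrite -[LHS](mulfK f1) H mul1r.
Qed.

Lemma eactXz f (z : int) : eact a (f ^ z) = eact a f ^ z.
Proof.
case: z => n; first exact: eactX.
by rewrite NegzE -!exprnN eactV eactX.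
Qed.

End Morphism.

Lemma padic_unit1 : padic_unit 1.
Proof. by exists 1; rewrite mulr1. Qed.

Lemma pow1X1 n : pow1X charE 1 n = 1 + Xroot n.
Proof.
apply: vge_eq => N; have [j Nj] := ex_pX N n.
have := @pow1X_approx 1 n j.
have : (absz ((1%R : padic p) j) = 1 %[mod p ^ j])%N.
  apply/eqP; rewrite -eqz_nat -!modz_nat gez0_abs ?padic_ge0//=.
  by rewrite modz_mod.
move=> /(@pow_mod n) H1 H2; apply: (vge_le Nj).
by have := vgeD H2 H1; rewrite expr1 addrA subrK.
Qed.

Lemma Xroot_exprz q n (z : int) : q * p%:R ^+ n = z%:~R ->
  Xroot n ^ z = emono charE 1 q.
Proof.
move=> qz.
have XE m : Xroot n ^+ m = emono charE 1 (m%:R / p%:R ^+ n).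
  apply/etildeP => r; rewrite coef_XrootX (@coef_mono _ _ _ _ _ n)//.
  by rewrite divfK// rpred_nat.
have qn : q * p%:R ^+ n \is a Num.int by rewrite qz intr_int.
have qE : q = z%:~R / p%:R ^+ n by rewrite -qz mulfK.
case: z => m in qz qE *; first by rewrite -exprnP XE qE.
rewrite NegzE -exprnN XE; set e := emono _ _ _.
have eq1 : e * emono charE 1 q = 1.
  rewrite /e (@emonoM _ _ _ _ n) ?divfK ?rpred_nat// mulr1 qE NegzE intrN.
  by rewrite mulNr subrr emono1.
have e0 : e != 0 by apply: contra_eq_neq eq1 => ->; rewrite mul0r eq_sym oner_eq0.
by rewrite -[RHS](mulKf e0) eq1 mulr1.
Qed.

Lemma scale_emono c q : c *: emono charE 1 q = emono charE c q.
Proof.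
apply/etildeP => r; rewrite coefZ /=; case: ifP => _; last by rewrite mulr0.
by rewrite /smono; case: ifP; rewrite ?mulr1 ?mulr0.
Qed.

Lemma eact_id f : eact 1 f = f.
Proof.
move: f; apply: etilde_ind => [|c q n qn|f g|f H].
- exact: eact0.
- rewrite (eact_mono padic_unit1 _ qn).
  have [z qz] := intrP qn.
  rewrite (XactE _ qz) pow1X1 (addrC 1) addrK.
  by rewrite (Xroot_exprz qz) scale_emono.
- by move=> fE gE; rewrite (eactD padic_unit1) fE gE.
- apply: vge_eq => N; have [g gE fg] := H N.
  have -> : eact 1 f - f = eact 1 (f - g) - (f - g).
    by rewrite (eactB padic_unit1) gE; ring.
  by apply: vgeB => //; exact: (eact_vge padic_unit1).
Qed.

Lemma eact_unique a (phi : {rmorphism Et -> Et}) : padic_unit a ->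
  (forall c f, phi (c *: f) = c *: phi f) ->
  (forall N f, vge N f -> vge N (phi f)) ->
  (forall n, phi (Xroot n) = pow1X charE a n - 1) ->
  forall f, phi f = eact a f.
Proof.
move=> ua phiZ phi_vge phiX; apply: etilde_ind => [|c q n qn|f g|f H].
- by rewrite rmorph0 eact0.
- have [z qz] := intrP qn.
  rewrite (eact_mono ua _ qn) -scale_emono -(Xroot_exprz qz) phiZ.
  by rewrite (XactE _ qz) fmorphXz phiX.
- by move=> fE gE; rewrite rmorphD (eactD ua) fE gE.
- apply: vge_eq => N; have [g gE fg] := H N.
  have -> : phi f - eact a f = phi (f - g) - eact a (f - g).
    by rewrite (eactB ua) rmorphB gE; ring.
  by apply: vgeB; [exact: phi_vge|exact: (eact_vge ua)].
Qed.

Section Composition.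
Variables (a b : padic p) (ua : padic_unit a) (ub : padic_unit b).

Lemma eact_pow1X n : eact a (pow1X charE b n) = pow1X charE (a * b) n.
Proof.
apply: vge_eq => N; have [j Nj] := ex_pX N n; apply: (vge_le Nj).
have H1 := eact_vge ua (@pow1X_approx b n j).
have H2 := @pow1X_approx (a * b) n j.
have H3 := @pow1X_approx a n j.
have a0 : vge 0 (pow1X charE a n).
  apply/vgeP => q /=; rewrite /pow1X_coef; case: ifP; last by rewrite eqxx.
  by rewrite natrEint pmulr_lge0// => /andP[].
have H4 := @vge_subX _ _ _ (absz (b j)) a0 (@vge0_1X n (absz (a j))) H3.
have : (absz ((a * b)%R j) = absz (a j) * absz (b j) %[mod p ^ j])%N.
  apply/eqP; rewrite -eqz_nat -!modz_nat gez0_abs ?padic_ge0//=.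
  by rewrite modz_mod PoszM !gez0_abs// padic_ge0.
move=> /(@pow_mod n); rewrite exprM => H5.
move: H1; rewrite (eactB ua) (eactX ua) (eactD ua) (eact1 ua) (eact_Xroot ua).
rewrite (addrC 1) subrK => H1.
have := vgeB (vgeD H1 H4) (vgeD H2 H5); congr vge; congr ecoef; ring.
Qed.

Lemma eact_comp f : eact a (eact b f) = eact (a * b) f.
Proof.
have uab := padic_unitM ua ub.
move: f; apply: etilde_ind => [|c q n qn|f g|f H].
- by rewrite eact0 eact0 eact0.
- rewrite (eact_mono ub _ qn) (eact_mono uab _ qn) eactZ; congr (_ *: _).
  have [z qz] := intrP qn.
  by rewrite !(XactE _ qz) (eactXz ua) (eactB ua) (eact1 ua) eact_pow1X.
- by move=> fE gE; rewrite (eactD ub) (eactD ua) (eactD uab) fE gE.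
- apply: vge_eq => N; have [g gE fg] := H N.
  have -> : eact a (eact b f) - eact (a * b) f =
            eact a (eact b (f - g)) - eact (a * b) (f - g).
    by rewrite (eactB ub) (eactB ua) (eactB uab) gE; ring.
  by apply: vgeB; [apply/(eact_vge ua)/(eact_vge ub)|exact: (eact_vge uab)].
Qed.

End Composition.

End ActionTheory.

Lemma padic_unitP (p : nat) (a : padic p) : prime p ->
  ~~ (p %| absz (a 1%N))%N -> padic_unit a.
Proof.
move=> p_pr pa.
have cop n : coprimez (a n) (p ^ n)%N%:Z.
  case: n => [|n]; first by rewrite coprimezE expn0 coprimen1.
  rewrite coprimezE absz_nat coprimeXr// coprime_sym prime_coprime//.
  apply: contra pa => pn; rewrite -(@padic_le _ a 1 n.+1)// expn1.
  rewrite -[p in (p %| _)%N]absz_nat -dvdzE; apply/dvdz_mod0P; rewrite modz_mod.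
  by apply/dvdz_mod0P; rewrite dvdzE.
have /choice[u uE] n : exists u, (u * a n = 1 %[mod (p ^ n)%N%:Z])%Z.
  have /coprimezP[[u v] /= uv] := cop n; exists u.
  by apply/eqP; rewrite eqz_mod_dvd -uv opprD addNKr dvdzE abszN -dvdzE dvdz_mull.
have uS n : (u n.+1 = u n %[mod (p ^ n)%N%:Z])%Z.
  have H : (u n.+1 * a n = 1 %[mod (p ^ n)%N%:Z])%Z.
    rewrite -(padicS a n) modzMmr -[LHS](@modz_dvdm _ _ (p ^ n.+1)%N%:Z).
      by rewrite uE modz_dvdm// dvdzE !absz_nat dvdn_exp2l.
    by rewrite dvdzE !absz_nat dvdn_exp2l.
  rewrite -[u n.+1]mulr1 -modzMmr -(uE n) modzMmr mulrCA -modzMmr H modzMmr.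
  by rewrite mulr1.
exists (padic_of uS); apply/padicP => n /=.
by rewrite modzMml uE.
Qed.

(* G acts on the valued group M through [act]; [cinv : Z_p -> G] is the inverse of
   the coordinate on G. *)
Section SuperHolder.
Variables (R : realType) (p : nat) (M : zmodType) (val : M -> \bar R).
Variables (G : Type) (act : G -> M -> M) (cinv : padic p -> G).

Definition super_holder (lam mu : R) : set M :=
  [set m | forall (x y : padic p) (i : nat), padic_val_ge i (x - y) ->
     ((p%:R `^ lam * p%:R ^+ i + mu)%:E
        <= val (act (cinv x) m - act (cinv y) m)%R)%E].

Definition super_holder_exp (lam : R) : set M :=
  \bigcup_(mu in [set: R]) super_holder lam mu.

Definition super_holder_vectors : set M :=
  \bigcup_(lam in [set: R]) super_holder_exp lam.

End SuperHolder.

(* the inverse of the coordinate c : 1 + p^k Z_p -> Z_p, c (1 + p^k x) = x *)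
Definition gamma_cinv (p k : nat) (x : padic p) : padic p := 1 + p%:R ^+ k * x.

Lemma padic_natE (p m n : nat) : (m%:R : padic p) n = (m%:Z %% (p ^ n)%N%:Z)%Z.
Proof.
elim: m => [//|m IHm].
by rewrite -natr1 /= -[padic_res _ _]/((m%:R : padic p) n) IHm modzDml modzDmr intS addrC.
Qed.

Lemma gamma_unit (p k : nat) (x : padic p) : prime p -> (0 < k)%N ->
  padic_unit (gamma_cinv k x).
Proof.
move=> p_pr; case: k => // k _; apply: padic_unitP => //.
have -> : gamma_cinv k.+1 x 1%N = 1.
  rewrite /gamma_cinv exprS -mulrA /= -[padic_res p%:R _]/((p%:R : padic p) 1%N).
  rewrite padic_natE expn1 modzz mul0r mod0z addr0 modz_mod.
  by rewrite modz_nat modn_small// prime_gt1.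
by rewrite dvdn1 neq_ltn prime_gt1 ?orbT.
Qed.

Section Main.
Variables (E : fieldType) (p : nat) (charE : p \in [pchar E]).
Notation Et := (Etilde charE).

Definition Elaurent (n : nat) : set Et := [set f | laurent p n f].
Definition Elaurent_oo : set Et := \bigcup_(n in [set: nat]) Elaurent n.

Definition valX (R : realType) (f : Et) : \bar R :=
  ereal_inf [set (ratr q)%:E | q in [set q | f q != 0]].

Lemma valX0 (R : realType) : valX R 0 = +oo%E.
Proof.
rewrite /valX (_ : [set q | _] = set0) ?image_set0 ?ereal_inf0//.
by apply/seteqP; split => // q /=; rewrite eqxx.
Qed.

Lemma valX_lead (R : realType) v (f : Et) : lead v f -> valX R f = (ratr v)%:E.
Proof.
move=> [fv /vgeP vf]; apply/le_anti/andP; split.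
  by apply: ereal_inf_lbound; exists v.
by apply: le_ereal_inf_tmp => _ [q /vf vq <-]; rewrite lee_fin ler_rat.
Qed.

Lemma valX_vge (R : realType) N (f : Et) :
  ((ratr N)%:E <= valX R f)%E <-> vge N f.
Proof.
have [->|/etilde_lead[v fv]] := eqVneq f 0; first by rewrite valX0 leey.
rewrite (valX_lead R fv) lee_fin ler_rat; split => H.
  exact: vge_le fv.2.
by apply: (vgeP _ _).2 H _ fv.1.
Qed.

Lemma valXM (R : realType) (f g : Et) : valX R (f * g) = (valX R f + valX R g)%E.
Proof.
have [->|f0] := eqVneq f 0.
  rewrite mul0r valX0; have [->|/etilde_lead[w gw]] := eqVneq g 0.
    by rewrite valX0.
  by rewrite (valX_lead R gw) addye.
have [->|g0] := eqVneq g 0.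
  rewrite mulr0 valX0; have [v fv] := etilde_lead f0.
  by rewrite (valX_lead R fv) addey.
have [v fv] := etilde_lead f0; have [w gw] := etilde_lead g0.
rewrite (valX_lead R fv) (valX_lead R gw) (valX_lead R (leadM fv gw)).
by rewrite rmorphD.
Qed.

Lemma valX_Xroot (R : realType) n : valX R (Xroot charE n) = (p%:R ^- n)%:E.
Proof.
rewrite (@valX_lead _ (p%:R ^- n)) ?fmorphV ?rmorphXn ?rmorph_nat//.
split; first by rewrite coef_Xroot /smono eqxx oner_eq0.
by apply/vgeP => q; rewrite coef_Xroot => /smono_neq0 ->.
Qed.

Lemma valX_eact (R : realType) a (f : Et) : padic_unit a ->
  valX R (eact a f) = valX R f.
Proof.
move=> ua; have [->|/etilde_lead[v fv]] := eqVneq f 0; first by rewrite eact0.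
by rewrite (valX_lead R fv) (valX_lead R (eact_lead ua fv)).
Qed.

End Main.

Arguments valX {E p} charE R f.
Arguments Elaurent {E p} charE n.
Arguments Elaurent_oo {E p} charE.
Arguments eact {E p charE} a f.
Arguments gamma_cinv {p} k x.

(* Main.v *)
(** Write T = X^(1/p^n). If a = b mod p^j then (1+T)^a and (1+T)^b agree up to
T^(p^j), whence T^z is moved by a relative amount T^(p^j - 1), and every element
of E((T)) is super-Hölder of exponent k - n.

Conversely, for g in E((T)) Taylor expansion gives
(1 + p^j).g - g = T^(p^j) (1 + T) g'(T) + (higher order), and g' <> 0 unless g lies
in E((T^p)); letting j grow, g can be super-Hölder of exponent k - m only if it
lies in E((X^(1/p^m))). A general f in the completion is reduced to this case by
the normalized traces, the projections onto the E((X^(1/p^n))) that kill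
(1+X)^i for i not in p^-n Z: they commute with the action and lose at most 1 of
valuation, so they preserve super-Hölder vectors, and they converge to the
identity. As E((X^(1/p^m))) is closed, f lies in it. *)

Require Import Defs.
From HB Require Import structures.
From mathcomp Require Import all_boot all_order all_algebra.
From mathcomp Require Import boolp classical_sets cardinality fsbigop.
From mathcomp Require Import reals ereal exp.
From mathcomp Require Import zify ring lra.
Import Defs.
Import Order.TTheory GRing.Theory Num.Theory.
Local Open Scope classical_set_scope.
Local Open Scope ring_scope.

Set Implicit Arguments. Unset Strict Implicit. Unset Printing Implicit Defensive.

(** * Units congruent modulo p^j, acting on E((X^(1/p^n))) *)

Lemma padic_unit_nat (p A : nat) : prime p -> coprime p A ->
  padic_unit (A%:R : padic p).
Proof.
move=> p_pr pA; apply: padic_unitP => //.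
rewrite padic_natE expn1 modz_nat absz_nat.
by rewrite /dvdn modn_mod -/(dvdn _ _) -prime_coprime.
Qed.

Section EtildeAux.
Variables (E : fieldType) (p : nat) (charE : p \in [pchar E]).
Notation Et := (Etilde charE).
Notation Xr := (Xroot charE).
Implicit Types (f g h e : Et) (a b : padic p).

Let p_pr : prime p. Proof. exact: pcharf_prime charE. Qed.
Let p_gt0 : (0 < p)%N. Proof. exact: prime_gt0 p_pr. Qed.
Let pX_gt0 n : 0 < p%:R ^+ n :> rat.
Proof. by rewrite exprn_gt0// ltr0n. Qed.
Let pX_neq0 n : p%:R ^+ n != 0 :> rat.
Proof. by rewrite gt_eqF. Qed.

Lemma laurent_mono n m (f : rat -> E) : (n <= m)%N -> laurent p n f -> laurent p m f.
Proof. by move=> nm [fn fM]; split => // q /fn; exact: pfrac_mono. Qed.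

Lemma vgeMn N f (n : nat) : vge N f -> vge N (f *+ n).
Proof.
move=> fN; elim: n => [|n IHn]; first by rewrite mulr0n; exact: vge0.
by rewrite mulrS; exact: vgeD.
Qed.

Lemma lead1D d e : 0 < d -> vge d e -> lead 0 (1 + e).
Proof.
move=> d0 ed; split.
  by rewrite coefD ed// addr0 coef1 /smono eqxx oner_eq0.
by apply: vgeD; [exact: vge1|apply: vge_le ed; exact: ltW].
Qed.

Lemma exprn1D_approx d e n : 0 < d -> vge d e ->
  vge (d + d) ((1 + e) ^+ n - 1 - e *+ n).
Proof.
move=> d0 ed; elim: n => [|n IHn].
  by rewrite expr0 mulr0n subr0 subrr; exact: vge0.
have -> : (1 + e) ^+ n.+1 - 1 - e *+ n.+1 =
    ((1 + e) ^+ n - 1 - e *+ n) * (1 + e) + (e * e) *+ n.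
  by rewrite exprSr mulrS -mulrnAl; ring.
apply: vgeD; last by apply: vgeMn; exact: vgeM.
by rewrite -[d + d]addr0; apply: vgeM => //; exact: (lead1D d0 ed).2.
Qed.

Lemma exprz1D_approx d e (z : int) : 0 < d -> vge d e ->
  vge (d + d) ((1 + e) ^ z - 1 - e *~ z).
Proof.
move=> d0 ed; case: z => n; first exact: exprn1D_approx.
have le := lead1D d0 ed; have e0 := lead_neq0 le.
have Vd : vge 0 (1 + e)^-1%R by have [_] := leadV le; rewrite oppr0.
(* A negative power of 1 + e is a positive power of 1 + e', and e' equals -e up to e^2 / (1 + e),
   which has order at least 2d. *)
pose e' := (1 + e)^-1 - 1.
have e'E : e' = - e * (1 + e)^-1 by rewrite /e' -{2}(divff e0); ring.
have e'd : vge d e' by rewrite e'E -[d]addr0; apply: vgeM => //; exact: vgeN.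
have ee' : e' + e = e * e * (1 + e)^-1.
  by rewrite e'E -[X in _ + X = _](mulfK e0); ring.
rewrite NegzE -exprnN mulrNz opprK -exprVn.
have -> : (1 + e)^-1 ^+ n.+1 - 1 + e *~ n.+1 =
   ((1 + e') ^+ n.+1 - 1 - e' *+ n.+1) + (e' + e) *+ n.+1.
  by rewrite -pmulrn [1 + e']addrC subrK (mulrnDl _ e') addrA subrK.
apply: vgeD; first exact: exprn1D_approx.
apply: vgeMn; rewrite ee' -[d + d]addr0; apply: vgeM => //; exact: vgeM.
Qed.

Lemma lead_Xroot n : lead (p%:R ^- n) (Xr n).
Proof.
split; first by rewrite coef_Xroot /smono eqxx oner_eq0.
by apply/vgeP => q; rewrite coef_Xroot => /smono_neq0 ->.
Qed.

Lemma lead_Xroot_exprz q n (z : int) : q * p%:R ^+ n = z%:~R -> lead q (Xr n ^ z).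
Proof.
move=> qz; have -> : q = p%:R ^- n * z%:~R by rewrite -qz mulrCA mulVf// mulr1.
exact/leadXz/lead_Xroot.
Qed.

(** Both sides agree with (1 + X^(1/p^n))^(A mod p^j) up to order p^j / p^n, for every j. *)
Lemma pow1X_nat A n : pow1X charE A%:R n = (1 + Xr n) ^+ A.
Proof.
apply: vge_eq => N; have [j Nj] := ex_pX charE N n.
have := @pow1X_approx _ _ charE A%:R n j.
have : (absz ((A%:R : padic p) j) = A %[mod p ^ j])%N.
  apply/eqP; rewrite -eqz_nat -!modz_nat gez0_abs ?(padic_ge0 charE)//.
  by rewrite padic_natE modz_mod.
move=> /(@pow_mod _ _ charE n) H1 H2; apply: (vge_le Nj).
by have := vgeD H2 H1; rewrite addrA subrK.
Qed.

Lemma pow1X_congr a b n j : a j = b j ->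
  vge (p%:R ^+ j / p%:R ^+ n) (pow1X charE a n - pow1X charE b n).
Proof.
move=> ab; have := vgeB (@pow1X_approx _ _ charE a n j) (@pow1X_approx _ _ charE b n j).
by rewrite ab; congr vge; congr ecoef; ring.
Qed.

(** Put T = X^(1/p^n). The images u and w of T differ by order at least p^j in T while w has order
    1, so u = w (1 + e) with e of order at least p^j - 1. Then u^z - w^z = w^z ((1 + e)^z - 1) has
    the same relative order, also for negative z because 0 < j gives e positive order. *)
Lemma Xact_congr a b n j q : padic_unit a -> padic_unit b -> (0 < j)%N ->
  a j = b j -> q * p%:R ^+ n \is a Num.int ->
  vge (q + (p%:R ^+ j - 1) / p%:R ^+ n) (Xact charE a q - Xact charE b q).
Proof.
move=> ua ub j0 abj qn; have [z qz] := intrP qn.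
have la := lead_pow1XB1_unit charE ua n; have lb := lead_pow1XB1_unit charE ub n.
have lq := (Xact_lead charE ub qn).2; move: lq.
rewrite !(XactE charE _ qz).
have := @pow1X_congr a b n j abj.
rewrite (_ : pow1X charE a n - _ = (pow1X charE a n - 1) - (pow1X charE b n - 1));
  last by ring.
move: (_ - 1) la (_ - 1) lb => u lu w lw uw lq.
have w0 := lead_neq0 lw.
pose e := (u - w) / w; set d := (p%:R ^+ j - 1) / p%:R ^+ n.
have d0 : 0 < d.
  by rewrite divr_gt0// subr_gt0 -natrX ltr1n -{1}(expn0 p) ltn_exp2l// prime_gt1.
have ed : vge d e.
  rewrite /d mulrBl mul1r; apply: vgeM => //; exact: (leadV lw).2.
have -> : u = w * (1 + e) by rewrite mulrDr mulr1 mulrC divfK// addrC subrK.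
rewrite expfzMl -[X in _ - X]mulr1 -mulrBr; apply: vgeM => //.
rewrite -(subrK (e *~ z) (_ - 1)); apply: vgeD.
  by apply: vge_le (exprz1D_approx _ d0 ed); lra.
by case: z {qz lq} => z; rewrite ?NegzE ?mulrNz; [|apply: vgeN]; exact: vgeMn.
Qed.

(** The relative bound of [Xact_congr] is the same for all exponents in p^-n Z, so it passes from
    monomials to the whole series. *)
Lemma eact_congr a b n j M f : padic_unit a -> padic_unit b -> (0 < j)%N ->
  a j = b j -> laurent p n f -> vge M f ->
  vge (M + (p%:R ^+ j - 1) / p%:R ^+ n) (eact a f - eact b f).
Proof.
move=> ua ub j0 abj [fn _] /vgeP fM r rM.
pose A := [set q | q < r + 1 /\ f q != 0].
have HA q : f q != 0 -> q <= r -> A q by move=> fq qr; split => //; lra.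
apply/eqP; rewrite coefB subr_eq0 (eactE ua HA) (eactE ub HA); apply/eqP.
apply: eq_fsbigr => q /set_mem[_ fq]; congr (_ * _).
apply/eqP; rewrite -subr_eq0 -coefB (Xact_congr ua ub j0 abj (fn _ fq))//.
by apply: lt_le_trans rM _; rewrite lerD2r fM.
Qed.

End EtildeAux.

(** * Normalized traces onto E((X^(1/p^n))) *)

Section NormalizedTrace.
Variables (E : fieldType) (p : nat) (charE : p \in [pchar E]).
Notation Et := (Etilde charE).
Notation Xr := (Xroot charE).
Implicit Types (f g h : Et).

Let p_pr : prime p. Proof. exact: pcharf_prime charE. Qed.
Let p_gt0 : (0 < p)%N. Proof. exact: prime_gt0 p_pr. Qed.
Let pX_gt0 n : 0 < p%:R ^+ n :> rat.
Proof. by rewrite exprn_gt0// ltr0n. Qed.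
Let pX_neq0 n : p%:R ^+ n != 0 :> rat.
Proof. by rewrite gt_eqF. Qed.
Let pXV_gt0 n : 0 < p%:R ^- n :> rat.
Proof. by rewrite invr_gt0. Qed.

(* The sign (-1)^j at r = j / p^N makes [ntrace n] kill (1 + X^(1/p^N))^b unless
   p^(N-n) divides b ([ntrace_1X]); being E((X^(1/p^n)))-linear, it then commutes
   with the action. *)
Definition ntrace_weight n (r : rat) : E :=
  if 0 <= r < p%:R ^- n then (-1) ^+ absz (numq r) else 0.

(** Each exponent q of f splits as a + r with a in p^-n Z and 0 <= r < p^-n; the monomial X^q is
    sent to X^a times the sign attached to r. *)
Definition ntrace_coef n (f : rat -> E) (a : rat) : E :=
  if a * p%:R ^+ n \is a Num.int
  then \sum_(q \in [set: rat]) ntrace_weight n (q - a) * f q else 0.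

Lemma ntrace_coefE n (f : rat -> E) a (A : set rat) : a * p%:R ^+ n \is a Num.int ->
  (forall q, f q != 0 -> a <= q -> q < a + p%:R ^- n -> A q) ->
  ntrace_coef n f a = \sum_(q \in A) ntrace_weight n (q - a) * f q.
Proof.
move=> an HA; rewrite /ntrace_coef an; apply/esym/fsbig_widen => // q [_ nA] /=.
apply/eqP; rewrite mulf_eq0; apply: contra_notT nA.
rewrite negb_or /ntrace_weight; case: ifP => [/andP[aq qa]|]; last by rewrite eqxx.
by move=> /andP[_ fq]; apply: HA => //; lra.
Qed.

Lemma ntrace_coef_neq0 n (f : rat -> E) a : ntrace_coef n f a != 0 ->
  exists q, [/\ f q != 0, a <= q & q < a + p%:R ^- n].
Proof.
rewrite /ntrace_coef; case: ifP; last by rewrite eqxx.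
move=> _ /(fsbigN1 (f := fun (_ : unit) q => ntrace_weight n (q - a) * f q) (x := tt)).
move=> [q _]; rewrite mulf_eq0 negb_or /ntrace_weight.
case: ifP => [/andP[aq qa]|]; last by rewrite eqxx.
by move=> /andP[_ fq]; exists q; split => //; lra.
Qed.

Lemma laurent_ntrace_coef n f : laurent p n (ntrace_coef n f).
Proof.
split=> [q|]; first by rewrite /ntrace_coef; case: ifP => //; rewrite eqxx.
have [M /vgeP fM] := etilde_vge f; exists (M - p%:R ^- n) => a.
by move=> /ntrace_coef_neq0[q [/fM]]; lra.
Qed.

Fact ntrace_subproof n f : `[< laurent_completion p (ntrace_coef n f) >].
Proof.
apply/asboolP => N; exists (ntrace_coef n f) => //; exists n.
exact: laurent_ntrace_coef.
Qed.

Definition ntrace n f : Et := MkEtilde charE (ntrace_subproof n f).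

Fact ntrace_linear n : linear (ntrace n).
Proof.
move=> c f g; apply/etildeP => a.
rewrite -[LHS]/(ntrace_coef n (c *: f + g) a).
rewrite -[RHS]/(c * ntrace_coef n f a + ntrace_coef n g a).
have [an|/negPf an] := boolP (a * p%:R ^+ n \is a Num.int); last first.
  by rewrite /ntrace_coef an mulr0 addr0.
pose A := [set q | q < a + p%:R ^- n /\ f q != 0] `|`
  [set q | q < a + p%:R ^- n /\ g q != 0].
have Afin : finite_set A.
  by rewrite finite_setU; split; exact: etilde_left_finite.
rewrite !(@ntrace_coefE n _ a A an); first 1 last.
- by move=> q gq _ qa; right.
- by move=> q fq _ qa; left.
- move=> q; have [fq|fq] := eqVneq (f q) 0; last by left.
  by rewrite coefD coefZ fq mulr0 add0r => gq _ qa; right.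
rewrite mulr_fsumr -fsbig_split//; apply: eq_fsbigr => q _.
by rewrite coefD coefZ mulrDr mulrCA.
Qed.

HB.instance Definition _ n :=
  GRing.isLinear.Build E Et Et *:%R (ntrace n) (ntrace_linear n).

Lemma pXV_le1 n : p%:R ^- n <= 1 :> rat.
Proof. by rewrite invf_le1// -natrX ler1n expn_gt0 p_gt0. Qed.

(** The coefficient at a only sees exponents below a + p^-n. Bounding this loss by 1 makes it
    uniform in n. *)
Lemma ntrace_vge n N f : vge N f -> vge (N - 1) (ntrace n f).
Proof.
move=> /vgeP fN; apply/vgeP => a /ntrace_coef_neq0[q [/fN]].
by have := pXV_le1 n; lra.
Qed.

Lemma pfrac_eq n (a q : rat) : a * p%:R ^+ n \is a Num.int -> q * p%:R ^+ n \is a Num.int ->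
  a <= q -> q < a + p%:R ^- n -> q = a.
Proof.
move=> /intrP[y ay] /intrP[z qz].
rewrite -(ler_pM2r (pX_gt0 n)) -(ltr_pM2r (pX_gt0 n)) mulrDl mulVf// ay qz.
rewrite ler_int -[1]/(1%:~R) -intrD ltr_int => yz zy.
by apply: (mulIf (pX_neq0 n)); rewrite ay qz; congr intmul; lia.
Qed.

Lemma ntrace_id n f : laurent p n f -> ntrace n f = f.
Proof.
move=> [fn _]; apply/etildeP => a /=.
have [an|an] := boolP (a * p%:R ^+ n \is a Num.int); last first.
  rewrite /ntrace_coef (negPf an); apply/esym/eqP; apply: contraNT an; exact: fn.
rewrite (@ntrace_coefE n _ a [set a])//.
  by rewrite fsbig_set1 subrr /ntrace_weight lexx pXV_gt0 (_ : numq 0 = 0)// expr0 mul1r.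
by move=> q /fn; exact: pfrac_eq.
Qed.

(** These [h] form a field. Once it is known to contain X^(1/p^n), it contains the integer powers of
    X^(1/p^n) and their images under an integer prime to p. *)
Definition ntrace_scalar n h := forall f, ntrace n (h * f) = h * ntrace n f.

Lemma ntrace_scalar_Xroot n : ntrace_scalar n (Xr n).
Proof.
move=> f; apply/etildeP => a; rewrite !(mulrC (Xr n)) coefXrootM.
rewrite -[LHS]/(ntrace_coef n (f * Xr n) a) -[RHS]/(ntrace_coef n f _) /ntrace_coef.
have <- : ((a - p%:R ^- n) * p%:R ^+ n \is a Num.int) = (a * p%:R ^+ n \is a Num.int).
  by rewrite mulrBl mulVf// rpredBr// rpred1.
case: ifP => // _; rewrite (reindex_fsbigT (fun q => q + p%:R ^- n)); last first.
  by exists (fun q => q - p%:R ^- n) => q; ring.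
apply: eq_fsbigr => q _; rewrite coefXrootM addrK.
by congr (ntrace_weight _ _ * _); ring.
Qed.

Lemma ntrace_scalar1 n : ntrace_scalar n 1.
Proof. by move=> f; rewrite !mul1r. Qed.

Lemma ntrace_scalarD n h1 h2 :
  ntrace_scalar n h1 -> ntrace_scalar n h2 -> ntrace_scalar n (h1 + h2).
Proof. by move=> H1 H2 f; rewrite !mulrDl linearD/= H1 H2. Qed.

Lemma ntrace_scalarN n h : ntrace_scalar n h -> ntrace_scalar n (- h).
Proof. by move=> H f; rewrite !mulNr linearN/= H. Qed.

Lemma ntrace_scalarM n h1 h2 :
  ntrace_scalar n h1 -> ntrace_scalar n h2 -> ntrace_scalar n (h1 * h2).
Proof. by move=> H1 H2 f; rewrite -!mulrA H1 H2. Qed.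

Lemma ntrace_scalarV n h : ntrace_scalar n h -> ntrace_scalar n h^-1.
Proof.
have [->|h0] := eqVneq h 0; first by rewrite invr0.
by move=> H f; apply: (mulfI h0); rewrite -H !mulVKf.
Qed.

Lemma ntrace_scalarX n h i : ntrace_scalar n h -> ntrace_scalar n (h ^+ i).
Proof.
move=> H; elim: i => [|i IHi]; first by rewrite expr0; exact: ntrace_scalar1.
by rewrite exprS; exact: ntrace_scalarM.
Qed.

Lemma ntrace_scalarXz n h (z : int) : ntrace_scalar n h -> ntrace_scalar n (h ^ z).
Proof.
move=> H; case: z => i; first exact: ntrace_scalarX.
by rewrite NegzE -exprnN; apply/ntrace_scalarV/ntrace_scalarX.
Qed.

Lemma ntrace_scalar_1X n b : ntrace_scalar n ((1 + Xr n) ^+ b).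
Proof.
apply/ntrace_scalarX/ntrace_scalarD; first exact: ntrace_scalar1.
exact: ntrace_scalar_Xroot.
Qed.

Lemma ntrace1 n : ntrace n 1 = 1.
Proof.
apply: ntrace_id; split=> [q|].
  by rewrite coef1 => /smono_neq0 ->; rewrite mul0r.
by exists 0 => q; rewrite coef1 => /smono_neq0 ->.
Qed.

(** Reduction to lowest terms divides j by a power of p, and (-1)^p = -1 in characteristic p, even
    when p = 2. So the sign may be read off any denominator p^N. *)
Lemma sign_pfrac j N : (-1) ^+ absz (numq (j%:R / p%:R ^+ N)) = (-1) ^+ j :> E.
Proof.
set q := _ / _; have qN : q * p%:R ^+ N = j%:R by rewrite divfK.
have [|dE] := @pfrac_denq E p charE q N; first by rewrite qN rpred_nat.
set t := logn _ _ in dE * => tN.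
have -> : j = (absz (numq q) * p ^ (N - t))%N.
  have q0 : 0 <= numq q by rewrite numq_ge0 divr_ge0 ?ler0n// ltW.
  apply/eqP; rewrite -eqz_nat PoszM gez0_abs// -(eqr_int rat) intrM numqE dE.
  by rewrite -!pmulrn -qN !natrX -[X in _ == X]mulrA -exprD subnKC.
rewrite mulnC exprM; congr (_ ^+ _).
rewrite exprNn_pchar ?expr1n//.
by rewrite (eq_pnat _ (pcharf_eq charE)) pnatX pnat_id.
Qed.

(** As j < p^s, the exponent j / p^(n+s) lies in [0, p^-n), and among the a in p^-n Z only a = 0
    sees it. *)
Lemma ntrace_XrootX n s j : (j < p ^ s)%N ->
  ntrace n (Xr (n + s) ^+ j) = ((-1) ^+ j : E) *: 1.
Proof.
move=> js; apply/etildeP => a; rewrite coefZ coef1 /= coef_XrootX.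
set q0 := j%:R / p%:R ^+ (n + s).
have q0_ge0 : 0 <= q0 by rewrite divr_ge0// ?ler0n// ltW.
have q0_lt : q0 < p%:R ^- n.
  rewrite /q0 exprD invfM mulrCA -[ltRHS]mulr1 ltr_pM2l//.
  by rewrite ltr_pdivrMr// mul1r -natrX ltr_nat.
have [an|an] := boolP (a * p%:R ^+ n \is a Num.int); last first.
  rewrite /ntrace_coef (negPf an) /smono ifN ?mulr0//.
  by apply: contraNneq an => ->; rewrite mul0r.
rewrite (@ntrace_coefE n _ a [set q0])//; last by move=> q /smono_neq0.
rewrite fsbig_set1 {1}/smono eqxx mulr1 /ntrace_weight /smono.
have [->|a0] := eqVneq a 0; first by rewrite subr0 q0_ge0 q0_lt sign_pfrac mulr1.
rewrite mulr0 ifN//; apply: contraNN a0 => /andP[aq qa]; apply/eqP.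
have [a_le0|a_gt0] := leP a 0.
  by apply/esym; apply: (pfrac_eq an); rewrite ?mul0r//; lra.
by apply: (@pfrac_eq n 0); rewrite ?mul0r//; lra.
Qed.

Lemma Xroot1D_Frob n s l : (1 + Xr (n + s)) ^+ (p ^ s * l) = (1 + Xr n) ^+ l.
Proof. by rewrite exprM Frob_add expr1n Xroot_Frob. Qed.

(** Put T = X^(1/p^(n+s)) and let b be the remainder of l modulo p^s. Up to a scalar (1 +
    X^(1/p^n))^i, this is the trace of (1 + T)^b. Since T^i has trace (-1)^i for i < p^s, the result
    is (1 - 1)^b, which vanishes as b > 0. *)
Lemma ntrace_1X n s l : ~~ (p ^ s %| l)%N -> ntrace n ((1 + Xr (n + s)) ^+ l) = 0.
Proof.
rewrite /dvdn => l0; rewrite (divn_eq l (p ^ s)) exprD mulnC Xroot1D_Frob.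
rewrite ntrace_scalar_1X.
have : (l %% p ^ s < p ^ s)%N by rewrite ltn_mod expn_gt0 p_gt0.
move: (l %% p ^ s)%N l0 => b b0 bs.
rewrite [X in ntrace n X]exprDn linear_sum/=.
have -> : \sum_(i < b.+1) ntrace n (1 ^+ (b - i) * Xr (n + s) ^+ i *+ 'C(b, i)) =
   (\sum_(i < b.+1) 1 ^+ (b - i) * (-1) ^+ i *+ 'C(b, i) : E) *: 1.
  rewrite scaler_suml; apply: eq_bigr => i _.
  rewrite linearMn/= !expr1n !mul1r -scalerMnl ntrace_XrootX//.
  by apply: leq_ltn_trans bs; rewrite -ltnS.
by rewrite -exprDn subrr expr0n (negPf b0) scale0r mulr0.
Qed.

(** * Commutation of the traces with integers prime to p *)

Section Equivariance.
Variables (n A : nat) (pA : coprime p A).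

Let uA := padic_unit_nat p_pr pA.
(** The defect of commutation. For an integer [A] the image of 1 + X^(1/p^m) is its A-th power, so
    that [ntrace_1X] applies to it; the converse inclusion only tests the integers 1 + p^j. *)
Let D f := ntrace n (eact A%:R f) - eact A%:R (ntrace n f).

Let DB f g : D (f - g) = D f - D g.
Proof. by rewrite /D (eactB uA) !linearB/= (eactB uA); ring. Qed.

Let DZ c f : D (c *: f) = c *: D f.
Proof. by rewrite /D eactZ !linearZ/= eactZ scalerBr. Qed.

Let DM h f : ntrace_scalar n h -> ntrace_scalar n (eact A%:R h) ->
  D (h * f) = eact A%:R h * D f.
Proof. by move=> H1 H2; rewrite /D (eactM uA) H2 H1 (eactM uA) mulrBr. Qed.

Let D1 : D 1 = 0.
Proof. by rewrite /D (eact1 _ uA) ntrace1 (eact1 _ uA) subrr. Qed.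

Lemma eact_nat_1X m l :
  eact A%:R ((1 + Xr m) ^+ l) = (1 + Xr m) ^+ (A * l).
Proof.
rewrite (eactX uA) (eactD uA) (eact1 _ uA) (eact_Xroot _ uA) pow1X_nat.
by rewrite (addrC 1) subrK exprM.
Qed.

(** If p^s divides l, the power is a scalar and so is its image. Otherwise p^s does not divide A l
    either, [A] being prime to p, and both traces vanish. *)
Let D_1X s l : D ((1 + Xr (n + s)) ^+ l) = 0.
Proof.
have [/dvdnP[l1 ->]|ls] := boolP (p ^ s %| l)%N.
  rewrite mulnC Xroot1D_Frob -[_ ^+ _]mulr1 DM ?D1 ?mulr0//.
    exact: ntrace_scalar_1X.
  by rewrite eact_nat_1X; exact: ntrace_scalar_1X.
rewrite /D eact_nat_1X !ntrace_1X ?eact0 ?subrr//.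
by rewrite Gauss_dvdr// coprimeXl.
Qed.

(** Writing T = (1 + T) - 1 trades each factor T for powers of 1 + T. *)
Let D_1X_XrootX s j l : D ((1 + Xr (n + s)) ^+ l * Xr (n + s) ^+ j) = 0.
Proof.
elim: j l => [|j IHj] l; first by rewrite expr0 mulr1.
have -> : (1 + Xr (n + s)) ^+ l * Xr (n + s) ^+ j.+1 =
  (1 + Xr (n + s)) ^+ l.+1 * Xr (n + s) ^+ j - (1 + Xr (n + s)) ^+ l * Xr (n + s) ^+ j.
  by rewrite !exprS; ring.
by rewrite DB !IHj subrr.
Qed.

Let D_mono c q m : q * p%:R ^+ m \is a Num.int -> D (emono charE c q) = 0.
Proof.
(* Enlarging m to n + m gives q = z / p^(n+m). With z = Q p^m + j and j >= 0, the factor X^(Q/p^n)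
   is a scalar for the trace, as is its image, and the other factor falls under [D_1X_XrootX]. *)
move=> /(pfrac_mono (leq_addl n m)) /intrP[z qz].
rewrite -scale_emono DZ -(Xroot_exprz _ qz) (divz_eq z (p ^ m)%N%:Z).
have pm0 : (p ^ m)%N%:Z != 0 :> int by rewrite eqz_nat -lt0n expn_gt0 p_gt0.
have := modz_ge0 z pm0; case: (modz _ _) => // j _.
have X0 := lead_neq0 (lead_Xroot charE (n + m)).
rewrite expfzDr// (mulrC (divz _ _)) -exprz_exp -[_ ^ (p ^ m)%N%:Z]/(_ ^+ (p ^ m)) Xroot_Frob.
rewrite DM.
- have := D_1X_XrootX m j 0; rewrite expr0 mul1r -[_ ^ j%:Z]/(_ ^+ j) => ->.
  by rewrite mulr0 scaler0.
- by apply/ntrace_scalarXz/ntrace_scalar_Xroot.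
rewrite (eactXz uA) (eact_Xroot _ uA) pow1X_nat; apply: ntrace_scalarXz.
apply: ntrace_scalarD; first exact: ntrace_scalar_1X.
by apply/ntrace_scalarN/ntrace_scalar1.
Qed.

Lemma ntrace_eact f : ntrace n (eact A%:R f) = eact A%:R (ntrace n f).
Proof.
apply/eqP; rewrite -subr_eq0 -/(D f); apply/eqP; move: f.
apply: etilde_ind => [|c q m|f g Df Dg|f H]; [|exact: D_mono| |].
- by rewrite /D eact0 linear0 eact0 subrr.
- have DN h : D h = 0 -> D (- h) = 0 by move=> Dh; rewrite -scaleN1r DZ Dh scaler0.
  by rewrite -[g]opprK DB Df (DN _ Dg) subrr.
(* The extra 1 makes up for the loss of valuation under the trace. *)
- apply: vge_all0 => N; have [g Dg fg] := H (N + 1).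
  rewrite -[D f]subr0 -Dg -DB /D.
  apply: vgeB.
    by rewrite -(addrK 1 N); apply: ntrace_vge; exact: (eact_vge uA).
  by apply: (eact_vge uA); rewrite -(addrK 1 N); exact: ntrace_vge.
Qed.

End Equivariance.

End NormalizedTrace.

(** * First-order expansion of the action of 1 + p^j *)

Section FirstOrder.
Variables (E : fieldType) (p : nat) (charE : p \in [pchar E]).
Notation Et := (Etilde charE).
Notation Xr := (Xroot charE).
Implicit Types (f g h : Et).

Let p_pr : prime p. Proof. exact: pcharf_prime charE. Qed.
Let p_gt0 : (0 < p)%N. Proof. exact: prime_gt0 p_pr. Qed.
Let pX_gt0 n : 0 < p%:R ^+ n :> rat.
Proof. by rewrite exprn_gt0// ltr0n. Qed.
Let pX_neq0 n : p%:R ^+ n != 0 :> rat.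
Proof. by rewrite gt_eqF. Qed.

Lemma coprime_1DpX j : (0 < j)%N -> coprime p (1 + p ^ j).
Proof.
move=> j0; rewrite prime_coprime// dvdn_addl ?dvdn_exp// dvdn1.
by rewrite neq_ltn prime_gt1 ?orbT.
Qed.

(** Put T = X^(1/p^n) and P = p^j. In characteristic p, (1 + T)^(1+P) - 1 = (1 + T)(1 + T^P) - 1 = T
    (1 + e) with e = T^(P-1) + T^P. Hence T^z is sent to T^z (1 + z e) up to relative order 2(P -
    1). *)
Lemma Xact_approx j n q (z : int) r : (0 < j)%N -> q * p%:R ^+ n = z%:~R ->
  r < q + (p%:R ^+ j - 1) / p%:R ^+ n + (p%:R ^+ j - 1) / p%:R ^+ n ->
  Xact charE (1 + p ^ j)%:R q r = smono 1 q r +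
    z%:~R * (smono 1 (q + (p%:R ^+ j - 1) / p%:R ^+ n) r +
             smono 1 (q + p%:R ^+ j / p%:R ^+ n) r).
Proof.
move=> j0 qz; set d := (_ - 1) / _.
have P1 : (1 < p ^ j)%N by rewrite -(expn0 p) ltn_exp2l// prime_gt1.
have d0 : 0 < d by rewrite divr_gt0// subr_gt0 -natrX ltr1n.
have dE : d = (p ^ j).-1%:R / p%:R ^+ n.
  by rewrite /d -natrX -subn1 natrB// ltnW.
have PE : p%:R ^+ j / p%:R ^+ n = (p ^ j)%:R / p%:R ^+ n :> rat by rewrite natrX.
pose e := Xr n ^+ (p ^ j).-1 + Xr n ^+ (p ^ j).
have ed : vge d e.
  apply: vgeD; rewrite ?dE; first exact: XrootX_vge.
  apply: vge_le (@XrootX_vge _ _ _ n (p ^ j)).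
  by rewrite ler_pM2r ?invr_gt0// ler_nat leq_pred.
have uE : pow1X charE (1 + p ^ j)%:R n - 1 = Xr n * (1 + e).
  rewrite pow1X_nat exprD expr1 Frob_add expr1n /e.
  by rewrite -{1 3}(prednK (ltnW P1)) !exprS; ring.
have qn : q * p%:R ^+ n \is a Num.int by rewrite qz intr_int.
have XqM i : (Xr n ^ z * Xr n ^+ i) r = smono 1 (q + i%:R / p%:R ^+ n) r.
  rewrite (Xroot_exprz _ qz) coefM (coef_mono _ _ qn) smono_mulE mul1r coef_XrootX.
  by rewrite /smono subr_eq (addrC _ q).
rewrite (XactE charE _ qz) uE expfzMl => rd.
have := vgeM (lead_Xroot_exprz charE qz).2 (exprz1D_approx z d0 ed).
move=> /(_ r); rewrite addrA => /(_ rd) H.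
have -> : Xr n ^ z * (1 + e) ^ z = Xr n ^ z * ((1 + e) ^ z - 1 - e *~ z) +
   (Xr n ^ z + z%:~R *: (Xr n ^ z * e)).
  by rewrite scaler_int -mulrzAr; ring.
rewrite coefD H add0r coefD coefZ mulrDr coefD !XqM -dE -PE.
by rewrite (Xroot_exprz _ qz) (coef_mono _ _ qn).
Qed.

Lemma Xact1 n q : q * p%:R ^+ n \is a Num.int -> Xact charE 1 q = smono 1 q :> (rat -> E).
Proof.
move=> qn; rewrite -(coef_mono charE _ qn); congr ecoef.
by rewrite -[RHS]eact_id (eact_mono charE (padic_unit1 p) _ qn) scale1r.
Qed.

(* The witness v is the least exponent of g not in p^-n Z, so that the leading term of the
   derivative of g in the variable X^(1/p^(n+1)) has exponent v - p^-(n+1). *)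
Lemma eact_first_order n g : laurent p n.+1 g -> ~ laurent p n g ->
  exists v, exists j0, forall j, (j0 <= j)%N ->
    (eact (1 + p ^ j)%:R g - g) (v + (p%:R ^+ j - 1) / p%:R ^+ n.+1) != 0.
Proof.
move=> [gn [M gM]] ngn.
have [q0 gq0 q0n] : exists2 q, g q != 0 & ~ (q * p%:R ^+ n \is a Num.int).
  apply: contrapT => H; apply: ngn; split; last by exists M.
  by move=> q gq; apply: contrapT => qn; apply: H; exists q.
pose g1 q := if q * p%:R ^+ n \is a Num.int then 0 else g q.
have g1E q : g1 q != 0 -> ~ (q * p%:R ^+ n \is a Num.int) /\ g q != 0.
  by rewrite /g1; case: ifP => //; rewrite eqxx.
have g1lf : left_finite g1.
  move=> N; apply: sub_finite_set (etilde_left_finite g N) => q [qN /g1E[_ ?]].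
  by split.
have g1q0 : g1 q0 != 0 by rewrite /g1; case: ifP.
have [v g1v /vgeP g1min] := left_finite_min g1lf g1q0.
have [vn gv] := g1E _ g1v; exists v.
have [y vy] := intrP (gn _ gv).
(* If p divided y = v p^(n+1), then v would lie in p^-n Z. *)
have y0 : y%:~R != 0 :> E.
  rewrite -(dvdz_pcharf charE); apply/negP => /dvdzP[w yw]; apply: vn.
  have -> : v * p%:R ^+ n = w%:~R; last exact: intr_int.
  have pn0 := pX_neq0 1; rewrite expr1 in pn0; apply: (mulIf pn0).
  by rewrite -mulrA -exprSr vy yw intrM.
(* Every exponent of g is at least M, so the second-order errors stay beyond the exponent under test
   as soon as v < M + (p^j - 1) / p^(n+1). *)
have [j1 Mj] := ex_pX charE (v - M + p%:R ^- n.+1) n.+1.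
exists j1.+1 => j jj.
have j0 : (0 < j)%N by apply: leq_trans jj.
have {}Mj : v < M + (p%:R ^+ j - 1) / p%:R ^+ n.+1.
  suff : p%:R ^+ j1 / p%:R ^+ n.+1 < p%:R ^+ j / p%:R ^+ n.+1 :> rat.
    by move: Mj; rewrite mulrBl mul1r; lra.
  by rewrite ltr_pM2r ?invr_gt0// -!natrX ltr_nat ltn_exp2l// prime_gt1.
have uA := padic_unit_nat p_pr (coprime_1DpX j0).
set r := v + _.
have vr : v <= r.
  rewrite lerDl divr_ge0//.
  by rewrite subr_ge0 -natrX ler1n expn_gt0 p_gt0.
pose S := [set q | q < r + 1 /\ g q != 0].
have finS : finite_set S by exact: etilde_left_finite.
have HS q : g q != 0 -> q <= r -> S q by move=> gq qr; split => //; lra.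
have Sv : S v by split => //; lra.
have -> : (eact (1 + p ^ j)%:R g - g) r = g v * y%:~R; last by rewrite mulf_neq0.
rewrite coefB -[X in _ - ecoef X _]eact_id (eactE uA HS) (eactE (padic_unit1 p) HS).
apply/eqP; rewrite subr_eq; apply/eqP.
transitivity (\sum_(q \in S) (g q * smono y%:~R v q + g q * Xact charE 1 q r)).
  apply: eq_fsbigr => q /set_mem[_ gq]; rewrite -mulrDr; congr (_ * _).
  have [z qz] := intrP (gn _ gq).
  rewrite (Xact_approx j0 qz); last first.
    by rewrite /r; have := gM _ gq; lra.
  rewrite (Xact1 (gn _ gq)) addrC; congr (_ + _).
  rewrite /smono /r (inj_eq (addIr _)) (eq_sym v).
  have dE : p%:R ^+ j / p%:R ^+ n.+1 =
      (p%:R ^+ j - 1) / p%:R ^+ n.+1 + p%:R ^- n.+1 :> rat by rewrite mulrBl mul1r subrK.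
  have d0 : 0 < p%:R ^- n.+1 :> rat by rewrite invr_gt0.
  rewrite dE; have [qv|qv] := eqVneq q v.
    have -> : z = y by apply/eqP; rewrite -(eqr_int rat) -qz -vy qv.
    rewrite ifN ?addr0 ?mulr1//; apply/eqP; lra.
  (* The only other possible contribution comes from q = v - p^-(n+1), through the term T^P of e. By
     minimality of v such a q lies in p^-n Z, so its integer z is divisible by p and the term
     vanishes. *)
  rewrite add0r; case: eqP => [vq|]; last by rewrite mulr0.
  have [qn|qn] := boolP (q * p%:R ^+ n \is a Num.int); last first.
    have qltv : q < v by lra.
    by have := g1min q; rewrite /g1 (negPf qn) leNgt qltv => /(_ gq).
  have [w qw] := intrP qn; rewrite mulr1; apply/eqP.
  rewrite -(dvdz_pcharf charE); apply/dvdzP; exists w; apply/eqP.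
  by rewrite -(eqr_int rat) intrM -qz -qw exprSr mulrA.
rewrite fsbig_split//=; congr (_ + _).
rewrite -(@fsbig_widen _ _ _ _ [set v])//.
- by rewrite fsbig_set1 /smono eqxx.
- by move=> q ->.
- by move=> q [_ /= qv]; rewrite /smono ifN ?mulr0//; apply/eqP.
Qed.

End FirstOrder.

(** * Super-Hölder vectors of exponent k - m and E((X^(1/p^m))) *)

Section SuperHolderLaurent.
Variables (R : realType) (E : fieldType) (p : nat) (charE : p \in [pchar E]).
Notation Et := (Etilde charE).
Implicit Types (f g : Et).

Let p_pr : prime p. Proof. exact: pcharf_prime charE. Qed.
Let p_gt0 : (0 < p)%N. Proof. exact: prime_gt0 p_pr. Qed.
Let pX_gt0 n : 0 < p%:R ^+ n :> R.
Proof. by rewrite exprn_gt0// ltr0n. Qed.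

Lemma valX_geP (c : R) f :
  (c%:E <= valX charE R f)%E <-> forall q, f q != 0 -> c <= ratr q.
Proof.
split=> [H q fq|H].
  by rewrite -lee_fin; apply: le_trans H _; apply: ereal_inf_lbound; exists q.
by apply: le_ereal_inf_tmp => _ [q /H cq <-]; rewrite lee_fin.
Qed.

Lemma powR_sub_nat (k m i : nat) :
  p%:R `^ (k%:R - m%:R) * p%:R ^+ i = p%:R ^+ (k + i) / p%:R ^+ m :> R.
Proof.
rewrite powRB; last by rewrite pnatr_eq0 -lt0n p_gt0 implybT.
by rewrite !powR_mulrn ?ler0n// exprD mulrAC.
Qed.

Lemma padic_res_addpX (b z : padic p) j : (b + p%:R ^+ j * z) j = b j.
Proof.
rewrite -natrX -[LHS]/((b j + ((p ^ j)%:R * z : padic p) j) %% (p ^ j)%N%:Z)%Z.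
rewrite -[((_ * _) : padic p) j]/((((p ^ j)%:R : padic p) j * z j) %% (p ^ j)%N%:Z)%Z.
by rewrite padic_natE modzz mul0r mod0z addr0 padic_mod.
Qed.

Lemma gamma_cinv_congr k (x y : padic p) i : padic_val_ge i (x - y) ->
  gamma_cinv k x (k + i)%N = gamma_cinv k y (k + i)%N.
Proof.
move=> [z xy]; have -> : gamma_cinv k x = gamma_cinv k y + p%:R ^+ (k + i) * z.
  rewrite /gamma_cinv -(subrK y x) xy mulrDr exprD -mulrA -!addrA.
  by congr (_ + _); rewrite addrC.
exact: padic_res_addpX.
Qed.

Lemma laurent_super_holder k m f : (0 < k)%N -> laurent p m f ->
  super_holder_exp (valX charE R) eact (gamma_cinv k) (k%:R - m%:R) f.
Proof.
move=> k0 fm; have [M fM] := etilde_vge f.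
(* The displacement has order at least M + (p^(k+i) - 1) / p^m; the part independent of i becomes
   the constant mu. *)
exists (ratr M - p%:R ^- m) => // x y i /(gamma_cinv_congr k) xy.
apply/valX_geP => q Hq; rewrite powR_sub_nat.
have ki : (0 < k + i)%N by rewrite addn_gt0 k0.
have := eact_congr (gamma_unit x p_pr k0) (gamma_unit y p_pr k0) ki xy fm fM.
move=> /vgeP/(_ _ Hq); rewrite -(ler_rat R) rmorphD fmorph_div rmorphB !rmorphXn/=.
rewrite !rmorph_nat rmorph1 mulrBl mul1r; lra.
Qed.

(** Descent on n. If f had an exponent outside p^-n Z with n >= m, [eact_first_order] would give the
    displacement an exponent growing like p^j / p^(n+1), at most half of the required p^j / p^m. *)
Lemma laurent_of_laurent k m n (mu : R) f : laurent p n f ->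
  (forall j, (k <= j)%N -> forall q, (eact (1 + p ^ j)%:R f - f) q != 0 ->
     p%:R ^+ j / p%:R ^+ m + mu <= ratr q) ->
  laurent p m f.
Proof.
move=> fn H; elim: n fn => [|n IHn] fn; first exact: laurent_mono fn.
have [nm|mn] := leqP n.+1 m; first exact: laurent_mono fn.
rewrite ltnS in mn; apply: IHn; apply: contrapT => nfn.
have [v [j0 Hv]] := eact_first_order fn nfn.
(* Beyond this threshold for p^j, half of p^j / p^m exceeds v - mu. *)
pose B := 2 * p%:R ^+ m * (ratr v - mu).
pose j := maxn (maxn j0 k) (Num.bound `|B|).
have jj0 : (j0 <= j)%N by rewrite !leq_max leqnn.
have jk : (k <= j)%N by rewrite !leq_max leqnn orbT.
have BpX : B < p%:R ^+ j.
  apply: le_lt_trans (ler_norm B) _.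
  apply: lt_trans (archi_boundP (normr_ge0 B)) _; rewrite -natrX ltr_nat.
  by apply: (@leq_ltn_trans j); rewrite ?leq_maxr// ltn_expl// prime_gt1.
have := H j jk _ (Hv j jj0).
rewrite rmorphD fmorph_div rmorphB !rmorphXn/= !rmorph_nat rmorph1 mulrBl mul1r.
have pn0 : 0 < p%:R ^- n.+1 :> R by rewrite invr_gt0.
have half : p%:R ^+ j / p%:R ^+ n.+1 <= p%:R ^+ j / p%:R ^+ m / 2 :> R.
  rewrite -mulrA ler_pM2l// -invfM lef_pV2 ?posrE ?mulr_gt0//.
  rewrite mulrC -natrX -natrM -natrX ler_nat expnS leq_mul ?prime_gt1//.
  by rewrite leq_exp2l// prime_gt1.
move=> le1.
have : p%:R ^+ j / p%:R ^+ m <= 2 * (ratr v - mu) by lra.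
by rewrite ler_pdivrMr// mulrAC leNgt BpX.
Qed.

(** Each [ntrace n f] inherits the bound with mu - 1 in place of mu, so its exponents lie in p^-m Z.
    Every coefficient of f is a coefficient of some [ntrace n f]. *)
Lemma laurent_of_eact k m (mu : R) f : (0 < k)%N ->
  (forall j, (k <= j)%N -> forall q, (eact (1 + p ^ j)%:R f - f) q != 0 ->
     p%:R ^+ j / p%:R ^+ m + mu <= ratr q) ->
  laurent p m f.
Proof.
move=> k0 H.
have Hn n : laurent p m (ntrace n f).
  apply: (@laurent_of_laurent k m n (mu - 1)); first exact: laurent_ntrace_coef.
  move=> j kj a.
  rewrite -(ntrace_eact n (coprime_1DpX charE (leq_trans k0 kj))) -linearB/=.
  move=> /ntrace_coef_neq0[q [/(H j kj) Hq _ qa]].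
  have : ratr q <= ratr a + 1 :> R.
    have -> : ratr a + 1 = ratr (a + 1) :> R by rewrite rmorphD rmorph1.
    by rewrite ler_rat; have := pXV_le1 charE n; lra.
  by lra.
split; last by have [M /vgeP fM] := etilde_vge f; exists M.
(* The trace fixes g and sends f - g, of order at least q + 2, to order at least q + 1. So f and its
   trace have the same coefficient at q. *)
move=> q fq; have [g [n gn] fg] := etilde_dense f (q + 2).
apply: (Hn n).1.
suff -> : ntrace n f q = f q by [].
have H1 : vge (q + 1) (ntrace n (f - g) - (f - g)).
  apply: vgeB; last by apply: vge_le fg; lra.
  by have := ntrace_vge n fg; congr vge; ring.
have : (ntrace n (f - g) - (f - g)) q = 0 by apply: H1; lra.
have -> : ntrace n (f - g) = ntrace n f - g by rewrite linearB/= (ntrace_id gn).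
rewrite opprB addrA subrK coefB.
by move/eqP; rewrite subr_eq0 => /eqP.
Qed.

Lemma super_holder_laurent k m f : (0 < k)%N ->
  super_holder_exp (valX charE R) eact (gamma_cinv k) (k%:R - m%:R) f ->
  laurent p m f.
Proof.
move=> k0 [mu _ Hf]; apply: (@laurent_of_eact k m mu) => // j kj q.
(* These coordinates correspond to the group elements 1 + p^j and 1. *)
have := Hf (p%:R ^+ (j - k)) 0 (j - k)%N.
have -> : gamma_cinv k (0 : padic p) = 1 by rewrite /gamma_cinv mulr0 addr0.
have -> : gamma_cinv k (p%:R ^+ (j - k)) = (1 + p ^ j)%:R :> padic p.
  by rewrite /gamma_cinv -exprD subnKC// natrD natrX.
rewrite eact_id powR_sub_nat subnKC// => /(_ _)/valX_geP; apply.
by exists 1; rewrite subr0 mulr1.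
Qed.

Lemma super_holder_exp_le k (lam lam' : R) f : lam <= lam' ->
  super_holder_exp (valX charE R) eact (gamma_cinv k) lam' f ->
  super_holder_exp (valX charE R) eact (gamma_cinv k) lam f.
Proof.
move=> ll [mu _ H]; exists mu => // x y i xy; apply: le_trans (H x y i xy).
rewrite lee_fin lerD2r ler_pM2r//; apply: ler_powR => //.
by rewrite ler1n.
Qed.

End SuperHolderLaurent.

Theorem theorem2p9 (R : realType) (E : fieldType) (p : nat)
    (charE : p \in [pchar E]) (k : nat)
    (k_ge1 : (1 <= k)%N) (k_ge2 : p = 2%N -> (2 <= k)%N) :
  (forall m : nat,
     super_holder_exp (valX charE R) eact (gamma_cinv k) (k%:R - m%:R) = Elaurent charE m) /\
  super_holder_vectors (valX charE R) eact (gamma_cinv k) = Elaurent_oo charE.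
Proof.
have shE m : super_holder_exp (valX charE R) eact (gamma_cinv k) (k%:R - m%:R) =
             Elaurent charE m.
  apply/seteqP; split => f; first exact: super_holder_laurent.
  exact: laurent_super_holder.
split=> //; apply/seteqP; split=> f [].
  (* With this m, k - m <= lam, and lowering the exponent weakens the condition. *)
  move=> lam _ Hf; pose m := Num.bound `|k%:R - lam|.
  exists m => //; rewrite -shE; apply: super_holder_exp_le Hf.
  have := archi_boundP (normr_ge0 (k%:R - lam)); rewrite -/m.
  by have := ler_norm (k%:R - lam); lra.
by move=> m _; rewrite -shE => Hf; exists (k%:R - m%:R).
Qed.
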